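(* Let $\lambda_{ij}\ge0$ ($i,j=1,\dots,k$, $i\ne j$) be fixed. If there is a strategy $(\chi,\psi)\in\mathscr F$ such that $$L(\chi,\psi)=\inf_{(\chi',\psi')\in\mathscr F}L(\chi',\psi'),\qquad(\ast)$$ then the following hold: (a) for any $r=1,2,\dots$, $$I_{\{l_r^\chi<f_{\theta_1}^{r,\chi}+R_r^\chi\}}\le\psi_r^\chi\le I_{\{l_r^\chi\le f_{\theta_1}^{r,\chi}+R_r^\chi\}}\quad \mu^r\text{-almost everywhere on } C_r^{\psi,\chi};$$ (b) for any $r=1,2,\dots$, $$\int V_{r+1}^\chi(y^{(r+1)})\,d\mu(y_{r+1})=R_r^\chi(y^{(r)})\quad \mu^r\text{-almost everywhere on }\bar C_r^{\psi,\chi};$$ (c) $\chi_1$ is such that $\int V_1^\chi\,d\mu(y_1)=R_0$. On the other hand, if a strategy $(\chi,\psi)$ satisfies (a), (b) and (c), and $(\chi,\psi)\in\mathscr F$, then $(\ast)$ holds.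
   Context: Model. There are $k\ge 2$ simple hypotheses $H_i:\theta=\theta_i$, $i=1,\dots,k$. A control variable takes values in a measurable space $\mathcal X$; observations take values in a measurable space $\mathcal Y$ with a $\sigma$-finite measure $\mu$. Under parameter $\theta$ and control $x$, an observation has density $f_\theta(y|x)$ with respect to $\mu$. Given controls $x_1,\dots,x_n$, the observations are independent, with joint density $f_\theta^n=f_\theta^n(x^{(n)},y^{(n)})=\prod_{i=1}^n f_\theta(y_i|x_i)$ with respect to $\mu^n=\mu\otimes\cdots\otimes\mu$. Here $x^{(n)}=(x_1,\dots,x_n)$, $y^{(n)}=(y_1,\dots,y_n)$. Strategies. A strategy $(\chi,\psi)$ consists of a control policy $\chi=(\chi_1,\chi_2,\dots)$ of measurable functions $\chi_n=\chi_n(x^{(n-1)},y^{(n-1)})$ with values in $\mathcal X$ ($\chi_1$ is a fixed element of $\mathcal X$), and a stopping rule $\psi=(\psi_1,\psi_2,\dots)$ of measurable functions $\psi_n=\psi_n(x^{(n)},y^{(n)})\in[0,1]$ (conditional probability of stopping at stage $n$ given that stage $n$ is reached). At each stage the control $x_n=\chi_n(x^{(n-1)},y^{(n-1)})$ is applied and then $y_n$ is observed. Notation. For $F_n=F_n(x^{(n)},y^{(n)})$, $F_n^\chi(y^{(n)})$ denotes $F_n(x^{(n)},y^{(n)})$ with $x_i=\chi_i(x^{(i-1)},y^{(i-1)})$, $i=1,\dots,n$; $f_\theta^{n,\chi}$ is the density of $Y^{(n)}$ under $\theta$ and $\chi$, and $E_\theta^\chi F_n=\int F_n^\chi f_\theta^{n,\chi}d\mu^n$.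 $I_A$ is the indicator of $A$. The stopping time $\tau_\psi$ satisfies $P_\theta^\chi(\tau_\psi=n)=E_\theta^\chi(1-\psi_1)\cdots(1-\psi_{n-1})\psi_n$. Put $s_n^{\psi,\chi}=(1-\psi_1^\chi)\cdots(1-\psi_{n-1}^\chi)\psi_n^\chi$. $C_n^{\psi,\chi}=\{y^{(n)}:(1-\psi_1^\chi(y^{(1)}))\cdots(1-\psi_{n-1}^\chi(y^{(n-1)}))>0\}$ for $n\ge2$, $C_1^{\psi,\chi}$ is the whole space of $y^{(1)}$, and $\bar C_n^{\psi,\chi}=\{y^{(n)}:(1-\psi_1^\chi(y^{(1)}))\cdots(1-\psi_n^\chi(y^{(n)}))>0\}$ for $n\ge1$. Objective. $l_n=\min_{1\le j\le k}\sum_{i\ne j}\lambda_{ij}f_{\theta_i}^n$, and $$L(\chi,\psi)=\sum_{n=1}^\infty\int s_n^{\psi,\chi}\left(nf_{\theta_1}^{n,\chi}+l_n^\chi\right)d\mu^n\ \text{ if }P_{\theta_1}^\chi(\tau_\psi<\infty)=1,\qquad L(\chi,\psi)=\infty\ \text{ otherwise.}$$ Class. $\mathscr F$ is the set of all strategies $(\chi,\psi)$ with $\lim_{n\to\infty}E_{\theta_i}^\chi(1-\psi_1)\cdots(1-\psi_n)=0$ for every $i=1,\dots,k$ (equivalently, $P_{\theta_i}^\chi(\tau_\psi<\infty)=1$ for all $i$). Functions $V_n,R_n$. For $N\ge1$ let $V_N^N=l_N$ and, recursively for $n=N,N-1,\dots,2$, $V_{n-1}^N=\min\{l_{n-1},f_{\theta_1}^{n-1}+R_{n-1}^N\}$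 with $R_{n-1}^N(x^{(n-1)},y^{(n-1)})=\min_{x_n}\int V_n^N(x^{(n)},y^{(n)})d\mu(y_n)$. The sequence $V_n^N$ is non-increasing in $N$; $V_n=\lim_{N\to\infty}V_n^N$, $R_n(x^{(n)},y^{(n)})=\min_{x_{n+1}}\int V_{n+1}(x^{(n+1)},y^{(n+1)})d\mu(y_{n+1})$ for $n\ge1$, and $R_0=\min_{x_1}\int V_1(x_1,y_1)d\mu(y_1)$. Standing assumption: all these functions defined by minima over the control are well-defined (minima attained) and measurable. *)

(* Defs.v *)
From HB Require Import structures.
From mathcomp Require Export all_boot all_order all_algebra.
From mathcomp Require Export all_classical all_reals all_analysis.
From mathcomp Require Export measurable_realfun.

Set Implicit Arguments.
Unset Strict Implicit.
Unset Printing Implicit Defensive.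
Import Order.TTheory GRing.Theory Num.Theory.
Import numFieldNormedType.Exports.

Local Open Scope classical_set_scope.
Local Open Scope ring_scope.

Section tuple_measure.
Context (d : measure_display) (Y : measurableType d) (R : realType).

Definition snoc n (p : n.-tuple Y * Y) : n.+1.-tuple Y :=
  [tuple of rcons p.1 p.2].

Lemma measurable_snoc n : measurable_fun [set: n.-tuple Y * Y] (@snoc n).
Proof.
apply/measurable_fun_tnthP => i.
have [lt_in|le_ni] := ltnP i n.
  rewrite (_ : _ \o _ = (@tnth n Y ^~ (Ordinal lt_in)) \o fst).
    exact: measurableT_comp (measurable_tnth _) measurable_fst.
  apply/funext => -[t y] /=.
  by rewrite !(tnth_nth y) /= nth_rcons size_tuple lt_in.
rewrite (_ : _ \o _ = snd); first exact: measurable_snd.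
apply/funext => -[t y] /=; rewrite (tnth_nth y) /= nth_rcons size_tuple.
by rewrite ltnNge le_ni eqn_leq le_ni -ltnS ltn_ord.
Qed.

Definition snoc_measure n (m : {measure set (n.-tuple Y) -> \bar R})
    (mu : {sigma_finite_measure set Y -> \bar R}) : set (n.+1.-tuple Y) -> \bar R :=
  pushforward (m \x mu)%E (@snoc n).

HB.instance Definition _ n m mu := Measure.copy (@snoc_measure n m mu)
  (measure_function_pushforward__canonical__measure_function_Measure
     [the measure _ _ of (m \x mu)%E] (@measurable_snoc n)).

(* mu^n, built by adjoining the last coordinate; mu^0 is the unit mass at the
   empty tuple. *)
Fixpoint tuple_measure (mu : {sigma_finite_measure set Y -> \bar R}) n :
    {measure set (n.-tuple Y) -> \bar R} :=
  if n is m.+1 then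
    [the measure _ _ of snoc_measure (tuple_measure mu m) mu]
  else [the measure _ _ of \d_([tuple] : 0.-tuple Y)].

Lemma tuple_measure_box (mu : {sigma_finite_measure set Y -> \bar R}) n
    (A : nat -> set Y) : (forall i, measurable (A i)) ->
  tuple_measure mu n [set t | forall i : 'I_n, A i (tnth t i)] =
  (\prod_(i < n) mu (A i))%E.
Proof.
move=> mA; elim: n => [|n IHn].
  rewrite big_ord0 /= diracE mem_set//= => -[]//.
rewrite big_ord_recr /= -IHn.
pose B := [set t : n.-tuple Y | forall i : 'I_n, A i (tnth t i)].
rewrite /snoc_measure /pushforward (_ : _ @^-1` _ = B `*` A n).
  apply: product_measure1E => //.
  rewrite (_ : B = \bigcap_(i in [set: 'I_n]) ((@tnth n Y ^~ i) @^-1` A i)).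
    apply: fin_bigcap_measurable => // i _.
    by rewrite -[X in measurable X]setTI; exact: measurable_tnth.
  by apply/seteqP; split => t /= Bt i; [move=> _; exact: Bt | exact: Bt i I].
apply/seteqP; split => -[t y] /= => [At|[Bt Ay] i].
  split=> [i|].
    have := At (widen_ord (leqnSn n) i).
    by rewrite !(tnth_nth y) /= nth_rcons size_tuple ltn_ord.
  have := At ord_max.
  by rewrite (tnth_nth y) /= nth_rcons size_tuple ltnn eqxx.
rewrite (tnth_nth y) /= nth_rcons size_tuple.
have [lt_in|le_ni] := ltnP i n.
  by have := Bt (Ordinal lt_in); rewrite (tnth_nth y).
have in_eq : i = n :> nat by apply/eqP; rewrite eqn_leq le_ni -ltnS ltn_ord.
by rewrite in_eq eqxx.
Qed.

End tuple_measure.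

(* A history (x^(n), y^(n)) is encoded as the list of pairs
   [:: (x_1, y_1); ...; (x_n, y_n)], so that a sequence of functions F_n of
   (x^(n), y^(n)), n = 0, 1, ..., is a single function of lists: F_n is its
   restriction to lists of length n.  Thus [control s h] is chi_(n+1) and
   [stop s h] is psi_n for n = size h; [stop s [::]] is never used. *)
Record strategy (R : realType) (dX dY : measure_display)
    (X : measurableType dX) (Y : measurableType dY) := Strategy {
  control : seq (X * Y) -> X ;
  stop : seq (X * Y) -> R ;
  measurable_control : forall n,
    measurable_fun [set: n.-tuple (X * Y)] (fun h : n.-tuple (X * Y) => control h) ;
  measurable_stop : forall n, (0 < n)%N ->
    measurable_fun [set: n.-tuple (X * Y)] (fun h : n.-tuple (X * Y) => stop h) ;
  stop01 : forall h, h != [::] -> 0 <= stop h <= 1 }.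

Section problem.
Context (R : realType) (dX dY : measure_display)
  (X : measurableType dX) (Y : measurableType dY)
  (mu : {sigma_finite_measure set Y -> \bar R})
  (k : nat) (hk : (1 < k)%N)
  (f : 'I_k -> X -> Y -> R) (lam : 'I_k -> 'I_k -> R).

Local Notation history := (seq (X * Y)).
Local Notation strategy := (strategy R X Y).
Implicit Types (s : strategy) (h : history).

Record is_density : Prop := IsDensity {
  density_ge0 : forall i x y, 0 <= f i x y ;
  density_measurable : forall i,
    measurable_fun [set: X * Y] (fun p => f i p.1 p.2) ;
  density_int1 : forall i x, (\int[mu]_y (f i x y)%:E = 1)%E }.

(* Hypotheses are numbered from 0: [hyp1] is the index of theta_1. *)
Definition hyp1 : 'I_k := Ordinal (ltnW hk).

Definition joint i h : R := \prod_(p <- h) f i p.1 p.2.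

(* l_n; [+oo] is only the neutral element of the minimum over j. *)
Definition loss h : \bar R :=
  \big[mine/+oo%E]_(j < k) (\sum_(i < k | i != j) lam i j * joint i h)%:E.

(* The history produced by the observations y; F_n^chi (y^(n)) is
   [F (play s y)]. *)
Definition play s (y : seq Y) : history :=
  foldl (fun h z => rcons h (control s h, z)) [::] y.

(* (1 - psi_1) ... (1 - psi_(n-1)) and (1 - psi_1) ... (1 - psi_n) at stage
   n = size h. *)
Definition reach s h : R := \prod_(1 <= i < size h) (1 - stop s (take i h)).
Definition pass s h : R :=
  \prod_(1 <= i < (size h).+1) (1 - stop s (take i h)).
Definition stop_at s h : R := reach s h * stop s h.

Definition expect i s n (F : history -> R) : \bar R :=
  (\int[tuple_measure mu n]_y (F (play s y) * joint i (play s y))%:E)%E.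

Definition prob_stop i s : \bar R :=
  (\sum_(1 <= n <oo) expect i s n (stop_at s))%E.

Definition objective s : \bar R :=
  if prob_stop hyp1 s == 1%E then
    (\sum_(1 <= n <oo) \int[tuple_measure mu n]_y
       ((stop_at s (play s y))%:E *
        ((n%:R * joint hyp1 (play s y))%:E + loss (play s y))))%E
  else +oo%E.

Definition finite_strategies : set strategy :=
  [set s | forall i, expect i s n (pass s) @[n --> \oo] --> 0%E].

Definition Cset s n : set (n.-tuple Y) := [set y | 0 < reach s (play s y)].
Definition Cbar s n : set (n.-tuple Y) := [set y | 0 < pass s (play s y)].

(* inf over the next control x of \int G (x^(n), x, y^(n), y) dmu(y). *)
Definition min_control (G : history -> \bar R) h : \bar R :=
  ereal_inf [set (\int[mu]_y G (rcons h (x, y)))%E | x in [set: X]].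

Fixpoint value_togo m h : \bar R :=
  if m is m'.+1 then
    mine (loss h) ((joint hyp1 h)%:E + min_control (value_togo m') h)%E
  else loss h.

(* V_n^N (h) and R_n^N (h) with n = size h; meaningful for n <= N, resp. n < N. *)
Definition VN N h : \bar R := value_togo (N - size h) h.
Definition RN N h : \bar R := min_control (VN N) h.

Lemma VN_size N h : size h = N -> VN N h = loss h.
Proof. by move=> <-; rewrite /VN subnn. Qed.

Lemma VN_rec N h : (size h < N)%N ->
  VN N h = mine (loss h) ((joint hyp1 h)%:E + RN N h)%E.
Proof.
move=> ltN; rewrite /RN /VN -(subnSK ltN) /=; congr (mine _ (_ + ereal_inf _))%E.
by apply: eq_imagel => x _; apply: eq_integral => y _; rewrite size_rcons.
Qed.

Definition V h : \bar R := limn (fun N => VN N h).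
(* R_n (h) with n = size h; R_0 is [Rinf [::]]. *)
Definition Rinf h : \bar R := min_control V h.

Record minima_attained_measurable : Prop := MinimaAttainedMeasurable {
  RN_attained : forall N h, (0 < size h < N)%N ->
    exists x, (\int[mu]_y VN N (rcons h (x, y)))%E = RN N h ;
  RN_measurable : forall N n, (0 < n < N)%N ->
    measurable_fun [set: n.-tuple (X * Y)] (fun h : n.-tuple (X * Y) => RN N h) ;
  Rinf_attained : forall h,
    exists x, (\int[mu]_y V (rcons h (x, y)))%E = Rinf h ;
  Rinf_measurable : forall n,
    measurable_fun [set: n.-tuple (X * Y)] (fun h : n.-tuple (X * Y) => Rinf h) }.

Definition optimal s :=
  objective s = ereal_inf [set objective s' | s' in finite_strategies].

Definition stop_condition s := forall r, (0 < r)%N ->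
  {ae tuple_measure mu r, forall y, Cset s y ->
    \1_[set h | (loss h < (joint hyp1 h)%:E + Rinf h)%E] (play s y)
    <= stop s (play s y) <=
    \1_[set h | (loss h <= (joint hyp1 h)%:E + Rinf h)%E] (play s y)}.

Definition control_condition s := forall r, (0 < r)%N ->
  {ae tuple_measure mu r, forall y, Cbar s y ->
    (\int[mu]_z V (play s (rcons y z)))%E = Rinf (play s y)}.

Definition first_control_condition s :=
  (\int[mu]_z V (play s [:: z]))%E = Rinf [::].

End problem.

(* Main.v *)
(* Backward induction in both directions.  Let c_n be the expected cost incurred
   by stopping exactly at stage n, and A_n = c_1 + ... + c_n plus the integral
   over "not stopped by stage n" of (n + 1) f_1^n + R_n.  The inequalities
   R_n <= \int V_{n+1} and V_n = min(l_n, f_1^n + R_n) <=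
   psi_n l_n + (1 - psi_n)(f_1^n + R_n) make A_n nondecreasing, starting from
   A_0 = 1 + R_0, and the step from A_n to A_{n+1} is an equality exactly when (b)
   (or (c), for n = 0) holds at n and (a) holds at n + 1, almost everywhere.  For a
   strategy in F, A_n is at most L(chi, psi): the remainder (n + 1) P_1(tau > n) is
   dominated by the tail of E_1 tau, and the one with R_n by a multiple of
   \sum_i P_i(tau > n).

   It remains to see that inf L <= 1 + R_0, where no measurable choice of a
   minimizing control is assumed.  Each V_n^N depends on the history only through
   (f_1^n, ..., f_k^n), and it is a Lipschitz function of it.  Hence countably many
   controls suffice to approach R_n^N at every history, and "the first one that is
   good enough" is a measurable near-minimizer; truncating at N and letting N go to
   infinity gives the bound. *)
From HB Require Import structures.
From mathcomp Require Import ring lra.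
Require Import Defs.
Set Implicit Arguments.
Unset Strict Implicit.
Unset Printing Implicit Defensive.
Import Order.TTheory GRing.Theory Num.Theory.
Import numFieldNormedType.Exports.
Local Open Scope classical_set_scope.
Local Open Scope ring_scope.

(** * Iterated integrals over the observations *)

Section unsnoc.
Context (d : measure_display) (T : measurableType d).

(** Two-sided inverse of [snoc]; it carries measurability and sigma-finiteness from products over to
    longer tuples. *)
Definition unsnoc n (t : n.+1.-tuple T) : n.-tuple T * T :=
  ([tuple tnth t (widen_ord (leqnSn n) i) | i < n], tnth t ord_max).

Lemma unsnocK n : cancel (@unsnoc n) (@snoc _ T n).
Proof.
move=> t; apply: eq_from_tnth => i; rewrite (tnth_nth (thead t)) /= nth_rcons.
rewrite size_map size_enum_ord; case: ltnP => [lt_in|le_ni].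
  rewrite (nth_map (Ordinal lt_in)) ?size_enum_ord//.
  rewrite -[X in nth _ _ X]/(val (Ordinal lt_in)) nth_ord_enum.
  by congr tnth; exact/val_inj.
have in_eq : i = n :> nat by apply/eqP; rewrite eqn_leq le_ni -ltnS ltn_ord.
by rewrite in_eq eqxx; congr tnth; exact/val_inj.
Qed.

Lemma snocK n : cancel (@snoc _ T n) (@unsnoc n).
Proof.
move=> [t y]; congr pair.
  apply: eq_from_tnth => i; rewrite tnth_mktuple !(tnth_nth y) /= nth_rcons.
  by rewrite size_tuple ltn_ord.
by rewrite (tnth_nth y) /= nth_rcons size_tuple ltnn eqxx.
Qed.

Lemma measurable_unsnoc n : measurable_fun [set: n.+1.-tuple T] (@unsnoc n).
Proof.
apply/measurable_fun_pairP; split; last exact: measurable_tnth.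
apply/measurable_fun_tnthP => i.
rewrite (_ : _ \o _ = @tnth n.+1 T ^~ (widen_ord (leqnSn n) i)).
  exact: measurable_tnth.
by apply/funext => t /=; rewrite tnth_mktuple.
Qed.

End unsnoc.

Section measurable_on_lists.
Context (d d' : measure_display) (T : measurableType d) (U : measurableType d').

(** A function of lists stands for a whole sequence F_0, F_1, ..., so measurability is asked
    separately at each length. *)
Definition seq_mfun (F : seq T -> U) := forall n,
  measurable_fun [set: n.-tuple T] (fun h : n.-tuple T => F h).

Lemma measurable_tuple0 (g : 0.-tuple T -> U) : measurable_fun [set: 0.-tuple T] g.
Proof.
rewrite (_ : g = cst (g [tuple])); first exact: measurable_cst.
by apply/funext => t; rewrite tuple0.
Qed.

Lemma measurable_tupleS n (g : n.+1.-tuple T -> U) :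
  measurable_fun [set: n.-tuple T * T] (fun p => g (snoc p)) ->
  measurable_fun [set: n.+1.-tuple T] g.
Proof.
move=> mg; rewrite (_ : g = (fun p => g (snoc p)) \o @unsnoc _ T n); last first.
  by apply/funext => t /=; rewrite unsnocK.
by apply: measurableT_comp => //; exact: measurable_unsnoc.
Qed.

Lemma seq_mfun_rcons (F : seq T -> U) n : seq_mfun F ->
  measurable_fun [set: n.-tuple T * T] (fun p => F (rcons p.1 p.2)).
Proof. by move=> mF; exact: measurableT_comp (mF n.+1) (@measurable_snoc _ _ n). Qed.

Lemma seq_mfun_rcons1 (F : seq T -> U) h : seq_mfun F ->
  measurable_fun [set: T] (fun z => F (rcons h z)).
Proof.
move=> mF; have := @measurableT_comp _ _ _ _ _ _ _ _ _ (seq_mfun_rcons (n := size h) mF)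
  (@measurable_pair1 _ _ _ _ (in_tuple h)).
exact.
Qed.

Lemma seq_mfun_take (F : seq T -> U) i : seq_mfun F ->
  seq_mfun (fun h => F (take i h)).
Proof.
move=> mF; elim=> [|n IHn]; first exact: measurable_tuple0.
have [le_in|lt_ni] := leqP i n.
  apply: measurable_tupleS.
  rewrite (_ : (fun p => _) = (fun h : n.-tuple T => F (take i h)) \o fst).
    exact: measurableT_comp.
  by apply/funext => -[t y] /=; rewrite -cats1 takel_cat ?size_tuple.
under eq_fun do rewrite take_oversize ?size_tuple//.
exact: mF.
Qed.

End measurable_on_lists.

Section tuple_integral.
Context (d : measure_display) (Y : measurableType d) (R : realType)
  (mu : {sigma_finite_measure set Y -> \bar R}).
Implicit Types F : seq Y -> \bar R.
Local Open Scope ereal_scope.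

(** Repackages a measure with a proof of sigma-finiteness, the form in which Tonelli's theorem
    accepts [tuple_measure]. *)
Lemma sigma_finite_measureP d' (T : measurableType d')
    (m : {measure set T -> \bar R}) : sigma_finite setT m ->
  exists m' : {sigma_finite_measure set T -> \bar R},
    [the measure _ _ of m' : set T -> \bar R] = m.
Proof.
move=> sf; pose H1 := isSFinite.Build _ _ _ _ (sfinite_measure_sigma_finite sf).
pose H2 := isSigmaFinite.Build _ _ _ _ sf.
exists (HB.pack_for (SigmaFiniteMeasure.type T R) (Measure.sort m) H1 H2).
exact: eq_measure.
Qed.

Lemma sigma_finite_tuple_measure n :
  sigma_finite [set: n.-tuple Y] (tuple_measure mu n).
Proof.
elim: n => [|n IHn].
  exists (fun=> setT); first by rewrite bigcup_const//; exists 0%N.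
  by move=> _; split => //=; rewrite diracT ltry.
have /sigma_finiteP[F [TF ndF Foo]] := IHn.
have /sigma_finiteP[G [TG ndG Goo]] := sigma_finiteT mu.
exists (fun i => @unsnoc _ Y n @^-1` (F i `*` G i)).
  rewrite -preimage_bigcup [X in _ @^-1` X](_ : _ = setT) ?preimage_setT//.
  apply/seteqP; split=> // -[x y] _.
  have [i _ Fix] : (\bigcup_i F i) x by rewrite -TF.
  have [j _ Gjy] : (\bigcup_i G i) y by rewrite -TG.
  (* Both exhausting sequences are nondecreasing, so one common index serves the two coordinates. *)
  exists (maxn i j) => //; split => /=.
  - by move: x Fix; exact/subsetPset/ndF/leq_maxl.
  - by move: y Gjy; exact/subsetPset/ndG/leq_maxr.
move=> i; have [? ?] := Foo i; have [? ?] := Goo i.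
have mFG : measurable (F i `*` G i) by exact: measurableX.
split; first by rewrite -[X in measurable X]setTI; exact: measurable_unsnoc.
rewrite /= /snoc_measure /pushforward -comp_preimage.
rewrite (_ : _ \o _ = id) ?preimage_id; last exact/funext/snocK.
by rewrite product_measure1E// lte_mul_pinfty// ge0_fin_numE.
Qed.

Lemma tuple_integral0 F : \int[tuple_measure mu 0]_y F y = F [::].
Proof.
by rewrite integral_dirac ?diracT ?mul1e//; exact: measurable_tuple0.
Qed.

(** Change of variables along [snoc], then Tonelli with the last observation innermost. *)
Lemma tuple_integralS n F : seq_mfun F -> (forall y, 0 <= F y) ->
  \int[tuple_measure mu n.+1]_y F y =
  \int[tuple_measure mu n]_y \int[mu]_z F (rcons y z).
Proof.
move=> mF F0; rewrite /= /snoc_measure.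
rewrite ge0_integral_pushforward//=; first last.
- exact: mF.
- exact: measurable_snoc.
rewrite preimage_setT.
have [m /= mE] := sigma_finite_measureP (sigma_finite_tuple_measure n).
rewrite -mE; apply: (fubini_tonelli1 (fun p : n.-tuple Y * Y => F (rcons p.1 p.2))) => //.
exact: seq_mfun_rcons.
Qed.

End tuple_integral.

(** * From equal integrals to equality almost everywhere *)

Section ge0_integral_eq.
Context (d : measure_display) (T : measurableType d) (R : realType)
  (m : {measure set T -> \bar R}).
Local Open Scope ereal_scope.

(** The nonnegative difference [g - f] has integral zero, the subtraction being legitimate because
    the integrals are finite. This turns equalities between costs into almost everywhere
    statements. *)
Lemma ge0_integral_eq_ae (f g : T -> \bar R) :
  measurable_fun setT f -> measurable_fun setT g ->
  (forall t, 0 <= f t) -> (forall t, f t <= g t) -> (forall t, g t < +oo) ->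
  \int[m]_t g t = \int[m]_t f t -> \int[m]_t f t < +oo ->
  {ae m, forall t, f t = g t}.
Proof.
move=> mf mg f0 fg goo eqI foo.
have g0 t : 0 <= g t := le_trans (f0 t) (fg t).
have f_int : m.-integrable setT f.
  by apply/integrableP; split => //; under eq_integral do rewrite gee0_abs//.
have g_int : m.-integrable setT g.
  apply/integrableP; split => //; under eq_integral do rewrite gee0_abs//.
  by rewrite eqI.
have gfin t : g t \is a fin_num by rewrite ge0_fin_numE.
have ffin t : f t \is a fin_num by rewrite ge0_fin_numE// (le_lt_trans (fg t)).
have : \int[m]_t `|g t - f t| = 0.
  under eq_integral do rewrite gee0_abs ?sube_ge0 ?ffin//.
  rewrite integralB//= eqI subee//.
  by rewrite ge0_fin_numE//; exact: integral_ge0.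
move/(ae_eq_integral_abs _ measurableT (emeasurable_funB mg mf)).
apply: filterS => t /(_ I) /eqP.
by rewrite /= sube_eq// ?add0e ?fin_num_adde_defr// => /eqP.
Qed.

End ge0_integral_eq.

Lemma measurable_bigmine (d : measure_display) (T : measurableType d)
    (R : realType) (I : Type) (r : seq I) (F : I -> T -> \bar R) :
  (forall i, measurable_fun setT (F i)) ->
  measurable_fun setT (fun t => \big[mine/+oo%E]_(i <- r) F i t).
Proof.
move=> mF; elim: r => [|i r IHr].
  by under eq_fun do rewrite big_nil; exact: measurable_cst.
by under eq_fun do rewrite big_cons; exact: measurable_mine.
Qed.

Lemma ecvgn_ge (R : realType) (u : nat -> \bar R) (l b : \bar R) N0 :
  u n @[n --> \oo] --> l -> (forall n, (N0 <= n)%N -> (b <= u n)%E) -> (b <= l)%E.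
Proof. by move=> ul bu; apply: cvge_ge ul; exists N0. Qed.

Lemma ecvgn_le (R : realType) (u : nat -> \bar R) (l b : \bar R) N0 :
  u n @[n --> \oo] --> l -> (forall n, (N0 <= n)%N -> (u n <= b)%E) -> (l <= b)%E.
Proof. by move=> ul ub; apply: cvge_le ul; exists N0. Qed.

Lemma fin_addeI (R : realType) (x a b : \bar R) :
  x \is a fin_num -> (x + a = x + b -> a = b)%E.
Proof.
move=> xfin /(congr1 (fun t => t - x)%E).
by rewrite addeAC subee// add0e addeAC subee// add0e.
Qed.

(** * Value functions *)

Section value_functions.
Context (R : realType) (dX dY : measure_display)
  (X : measurableType dX) (Y : measurableType dY)
  (mu : {sigma_finite_measure set Y -> \bar R})
  (k : nat) (hk : (1 < k)%N)
  (f : 'I_k -> X -> Y -> R) (lam : 'I_k -> 'I_k -> R)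
  (hf : is_density mu f)
  (hlam : forall i j, i != j -> 0 <= lam i j)
  (hmin : minima_attained_measurable mu hk f lam).

Local Notation history := (seq (X * Y)).
Local Notation joint := (joint f).
Local Notation loss := (loss f lam).
Local Notation hyp1 := (hyp1 hk).
Local Notation min_control := (min_control mu).
Local Notation value_togo := (value_togo mu hk f lam).
Local Notation VN := (VN mu hk f lam).
Local Notation RN := (RN mu hk f lam).
Local Notation V := (V mu hk f lam).
Local Notation Rinf := (Rinf mu hk f lam).
Implicit Types (h : history) (F G : history -> \bar R).

(** Integrating out the next observation gives [mass] back, whatever the control, so its multiples
    can dominate the values at all stages and for all strategies. *)
Definition mass h : R := \sum_(i < k) joint i h.
(** Absolute values, because the sign of [lam] is prescribed only off the diagonal. *)
Definition lam_norm : R := \sum_(i < k) \sum_(j < k) `|lam i j|.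

Lemma joint_nil i : joint i [::] = 1.
Proof. by rewrite /joint big_nil. Qed.

Lemma joint_rcons i h x y : joint i (rcons h (x, y)) = joint i h * f i x y.
Proof. by rewrite /joint -cats1 big_cat big_seq1. Qed.

Lemma joint_ge0 i h : 0 <= joint i h.
Proof. by rewrite /joint prodr_ge0// => p _; exact: (density_ge0 hf). Qed.

Lemma mass_ge0 h : 0 <= mass h.
Proof. by rewrite /mass sumr_ge0// => i _; exact: joint_ge0. Qed.

Lemma lam_norm_ge0 : 0 <= lam_norm.
Proof. by rewrite /lam_norm sumr_ge0// => i _; rewrite sumr_ge0. Qed.

Lemma measurable_joint i : seq_mfun (joint i).
Proof.
elim=> [|n IHn]; first exact: measurable_tuple0.
apply: measurable_tupleS.
rewrite (_ : (fun p => _) =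
    (fun p : n.-tuple (X * Y) * (X * Y) => joint i p.1 * f i p.2.1 p.2.2)).
  apply: measurable_funM; first exact: (measurableT_comp IHn measurable_fst).
  exact: (measurableT_comp (density_measurable hf i) measurable_snd).
by apply/funext => -[h [x y]] /=; rewrite joint_rcons.
Qed.

Lemma measurable_mass : seq_mfun mass.
Proof. by move=> n; apply: measurable_sum => i; exact: measurable_joint. Qed.

Lemma measurable_next d (U : measurableType d) (F : history -> U) h x :
  seq_mfun F -> measurable_fun setT (fun z => F (rcons h (x, z))).
Proof.
move=> mF.
have := @measurableT_comp _ _ _ _ _ _ _ _ _ (seq_mfun_rcons1 h mF)
  (@measurable_pair1 _ _ _ _ x).
exact.
Qed.

Lemma seq_mfun_EFin d (T : measurableType d) (F : seq T -> R) :
  seq_mfun F -> seq_mfun (EFin \o F).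
Proof. by move=> mF n; apply/measurable_EFinP; exact: mF. Qed.

Lemma integral_jointM (c : R) i h x : 0 <= c ->
  (\int[mu]_z (c * joint i (rcons h (x, z)))%:E = (c * joint i h)%:E)%E.
Proof.
move=> c0; under eq_integral do rewrite joint_rcons mulrA EFinM.
rewrite ge0_integralZl_EFin//.
- by rewrite (density_int1 hf) mule1.
- by move=> z _; rewrite lee_fin (density_ge0 hf).
- apply/measurable_EFinP.
  exact: measurableT_comp (density_measurable hf i) (@measurable_pair1 _ _ _ _ x).
- by rewrite mulr_ge0// joint_ge0.
Qed.

Lemma integral_massM (c : R) h x : 0 <= c ->
  (\int[mu]_z (c * mass (rcons h (x, z)))%:E = (c * mass h)%:E)%E.
Proof.
move=> c0; under eq_integral do rewrite /mass mulr_sumr -sumEFin.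
rewrite ge0_integral_sum//.
- by under eq_bigr do rewrite integral_jointM//; rewrite sumEFin mulr_sumr.
- move=> i; apply/measurable_EFinP/measurable_funM => //.
  exact: measurable_next (measurable_joint i).
- by move=> i z _; rewrite lee_fin mulr_ge0// joint_ge0.
Qed.

Lemma loss_ge0 h : (0 <= loss h)%E.
Proof.
apply: le_bigmin => // j _; rewrite lee_fin sumr_ge0// => i ij.
by rewrite mulr_ge0 ?joint_ge0// hlam.
Qed.

Lemma lam_le_norm i j : lam i j <= lam_norm.
Proof.
rewrite (le_trans (ler_norm _))// /lam_norm (bigD1 i)//= (bigD1 j)//=.
by rewrite -addrA lerDl addr_ge0// ?sumr_ge0// => a _; rewrite sumr_ge0.
Qed.

Lemma loss_le_mass h : (loss h <= (lam_norm * mass h)%:E)%E.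
Proof.
(* A single term of the minimum suffices; [hyp1] is an index that is sure to exist. *)
apply: (le_trans (bigmin_le _ hyp1 _)); rewrite lee_fin /mass mulr_sumr.
rewrite big_mkcond ler_sum// => i _; case: ifPn => _.
  by rewrite ler_wpM2r ?joint_ge0// lam_le_norm.
by rewrite mulr_ge0 ?joint_ge0// lam_norm_ge0.
Qed.

Lemma measurable_loss : seq_mfun loss.
Proof.
move=> n; apply: measurable_bigmine => j; apply/measurable_EFinP.
under eq_fun do rewrite big_mkcond; apply: measurable_sum => i.
case: (i != j) => //; apply: measurable_funM => //; exact: measurable_joint.
Qed.

(** * Infima over the next control *)

Lemma min_control_ge0 F h : (forall h, 0 <= F h)%E -> (0 <= min_control F h)%E.
Proof.
by move=> F0; apply/ereal_infP => _ [x _ <-]; exact: integral_ge0.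
Qed.

Lemma min_control_le F h x :
  (min_control F h <= \int[mu]_z F (rcons h (x, z)))%E.
Proof. by apply: ereal_inf_lbound; exists x. Qed.

Lemma le_min_control F G h : seq_mfun F -> seq_mfun G ->
  (forall h, 0 <= F h)%E -> (forall h, F h <= G h)%E ->
  (min_control F h <= min_control G h)%E.
Proof.
move=> mF mG F0 FG; apply/ereal_infP => _ [x _ <-].
apply: le_trans (min_control_le F h x) _.
by apply: ge0_le_integral => //; exact: measurable_next.
Qed.

(** Passes from the horizon [N] to the number of remaining stages, the variable on which
    [value_togo] recurses. *)
Lemma RN_togo N h : RN N h = min_control (value_togo (N - (size h).+1)) h.
Proof.
congr ereal_inf; apply: eq_imagel => x _.
by apply: eq_integral => y _; rewrite /VN size_rcons.
Qed.

Lemma value_togoS m h : value_togo m.+1 h =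
  mine (loss h) ((joint hyp1 h)%:E + min_control (value_togo m) h)%E.
Proof. by []. Qed.

Lemma value_togo_ge0 m h : (0 <= value_togo m h)%E.
Proof.
elim: m h => [|m IHm] h /=; first exact: loss_ge0.
by rewrite le_min loss_ge0/= adde_ge0 ?lee_fin ?joint_ge0// min_control_ge0.
Qed.

Lemma value_togo_le_loss m h : (value_togo m h <= loss h)%E.
Proof. by case: m => [|m] //=; rewrite ge_min lexx. Qed.

Lemma measurable_min_control_togo m : seq_mfun (min_control (value_togo m)).
Proof.
case=> [|n]; first exact: measurable_tuple0.
(* With horizon [n.+1 + m.+1], exactly [m] stages remain after the next one. Length 0, which
   [RN_measurable] does not cover, was trivial: there is only one empty tuple. *)
have ltn : (0 < n.+1 < n.+1 + m.+1)%N by rewrite /= -addSnnS ltnS leq_addr.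
have := RN_measurable hmin ltn; congr measurable_fun; apply/funext => h.
by rewrite RN_togo// size_tuple -addSnnS addKn.
Qed.

Lemma measurable_value_togo m : seq_mfun (value_togo m).
Proof.
case: m => [|m] n; first exact: measurable_loss.
under eq_fun do rewrite value_togoS.
apply: measurable_mine; first exact: measurable_loss.
apply: emeasurable_funD; last exact: measurable_min_control_togo.
by apply/measurable_EFinP; exact: measurable_joint.
Qed.

Lemma measurable_RN N : seq_mfun (RN N).
Proof.
move=> n; under eq_fun do rewrite RN_togo size_tuple.
exact: measurable_min_control_togo.
Qed.

(** One more stage only adds an option; the gain propagates backward because [min_control] is
    monotone. *)
Lemma value_togo_ge m h : (value_togo m.+1 h <= value_togo m h)%E.
Proof.
elim: m h => [|m IHm] h; first exact: value_togo_le_loss.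
rewrite 2!value_togoS; apply: le_min2 => //; apply: leeD2l.
apply: le_min_control => //.
- exact: measurable_value_togo.
- exact: measurable_value_togo.
- exact: value_togo_ge0.
Qed.

(** * Monotonicity in the horizon and passage to the limit *)

Lemma VN_ge0 N h : (0 <= VN N h)%E. Proof. exact: value_togo_ge0. Qed.

Lemma VN_le_mass N h : (VN N h <= (lam_norm * mass h)%:E)%E.
Proof. exact: le_trans (value_togo_le_loss _ _) (loss_le_mass _). Qed.

Lemma measurable_VN N : seq_mfun (VN N).
Proof.
move=> n; rewrite /VN; under eq_fun do rewrite size_tuple.
exact: measurable_value_togo.
Qed.

Lemma VN_nonincreasing h : {homo VN^~ h : n m / (n <= m)%N >-> (m <= n)%E}.
Proof.
move=> n m /subnK <-; elim: (m - n)%N => [|p IHp]; first by rewrite add0n.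
apply: le_trans IHp; rewrite /VN addSn; have [le_h|lt_h] := leqP (size h) (p + n).
  by rewrite subSn// value_togo_ge.
(* Past the horizon both truncated subtractions are 0, so both values are [loss h]. *)
by rewrite (eqP lt_h) (eqP (ltnW lt_h)).
Qed.

Lemma RN_nonincreasing h : {homo RN^~ h : n m / (n <= m)%N >-> (m <= n)%E}.
Proof.
move=> n m nm; apply: le_min_control => //.
- exact: measurable_VN.
- exact: measurable_VN.
- exact: VN_ge0.
- by move=> h'; exact: VN_nonincreasing.
Qed.

Lemma VN_cvg h : VN N h @[N --> \oo] --> V h.
Proof.
have cvgV := ereal_nonincreasing_cvgn (VN_nonincreasing h).
by rewrite /V (cvg_lim _ cvgV).
Qed.

Lemma V_le_VN N h : (V h <= VN N h)%E.
Proof.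
have cvgV := ereal_nonincreasing_cvgn (VN_nonincreasing h).
by rewrite /V (cvg_lim _ cvgV)//; apply: ereal_inf_lbound; exists N.
Qed.

Lemma V_ge0 h : (0 <= V h)%E.
Proof. by apply: (ecvgn_ge (N0 := 0) (VN_cvg (h := h))) => N _; exact: VN_ge0. Qed.

Lemma V_le_mass h : (V h <= (lam_norm * mass h)%:E)%E.
Proof. exact: le_trans (V_le_VN 0 h) (VN_le_mass 0 h). Qed.

Lemma measurable_V : seq_mfun V.
Proof.
move=> n; apply: (emeasurable_fun_cvg (fun N (h : n.-tuple (X * Y)) => VN N h)).
- by move=> N; exact: measurable_VN.
- by move=> h _; exact: VN_cvg.
Qed.

(** Dominated convergence, with [lam_norm * mass] as the integrable bound. *)
Lemma integral_VN_cvg h x :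
  (\int[mu]_z VN N (rcons h (x, z)))%E @[N --> \oo] -->
  (\int[mu]_z V (rcons h (x, z)))%E.
Proof.
apply: (@dominated_cvg _ _ _ _ _ measurableT _ _
  (fun z => (lam_norm * mass (rcons h (x, z)))%:E)).
- by move=> N; apply: measurable_next; exact: measurable_VN.
- by move=> z _; exact: VN_cvg.
- by [].
- apply/integrableP; split.
    apply/measurable_EFinP/measurable_funM => //.
    exact: measurable_next measurable_mass.
  under eq_integral do rewrite gee0_abs ?lee_fin ?mulr_ge0 ?lam_norm_ge0 ?mass_ge0//.
  by rewrite integral_massM ?ltry// lam_norm_ge0.
- by move=> N z _; rewrite gee0_abs ?VN_ge0// VN_le_mass.
Qed.

(** By monotonicity in [N] the limits are infima, and the infimum over [N] commutes with the one
    over the control. *)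
Lemma RN_cvg h : RN N h @[N --> \oo] --> Rinf h.
Proof.
have cvgR := ereal_nonincreasing_cvgn (RN_nonincreasing h).
suff -> : Rinf h = ereal_inf (range (RN^~ h)) by [].
apply/eqP; rewrite eq_le; apply/andP; split; apply/ereal_infP.
  move=> _ [N _ <-]; apply: le_min_control => //.
  - exact: measurable_V.
  - exact: measurable_VN.
  - exact: V_ge0.
  - by move=> h'; exact: V_le_VN.
move=> _ [x _ <-]; apply: (ecvgn_ge (N0 := 0) (integral_VN_cvg (h := h) (x := x))) => N _.
by apply: le_trans (min_control_le _ h x); apply: ereal_inf_lbound; exists N.
Qed.

Lemma Rinf_le_RN N h : (Rinf h <= RN N h)%E.
Proof.
apply: (ecvgn_le (N0 := N) (RN_cvg (h := h))) => M NM.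
exact: RN_nonincreasing.
Qed.

(** The witness [x0] prevents the infimum from ranging over no control at all, which would make it
    [+oo]. *)
Lemma min_control_le_mass F h (x0 : X) : seq_mfun F -> (forall h, 0 <= F h)%E ->
  (forall h, F h <= (lam_norm * mass h)%:E)%E ->
  (min_control F h <= (lam_norm * mass h)%:E)%E.
Proof.
move=> mF F0 Fle; apply: le_trans (min_control_le F h x0) _.
rewrite -(integral_massM h x0 lam_norm_ge0); apply: ge0_le_integral => //.
- exact: measurable_next.
- apply/measurable_EFinP/measurable_funM => //.
  exact: measurable_next measurable_mass.
Qed.

(** Limit of the recursion [VN_rec] as the horizon grows. *)
Lemma V_rec h : V h = mine (loss h) ((joint hyp1 h)%:E + Rinf h)%E.
Proof.
apply/eqP; rewrite eq_le; apply/andP; split.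
  have V_le_loss : (V h <= loss h)%E.
    exact: le_trans (V_le_VN 0 h) (value_togo_le_loss _ _).
  rewrite le_min V_le_loss/=.
  have cvgR : ((joint hyp1 h)%:E + RN N h)%E @[N --> \oo] -->
      ((joint hyp1 h)%:E + Rinf h)%E.
    by apply: cvgeD; [exact: fin_num_adde_defr|exact: cvg_cst|exact: RN_cvg].
  apply: (ecvgn_ge (N0 := (size h).+1) cvgR) => N hN.
  by apply: le_trans (V_le_VN N h) _; rewrite VN_rec// ge_min lexx orbT.
apply: (ecvgn_ge (N0 := 0) (VN_cvg (h := h))) => N _.
have [Nh|hN] := leqP N (size h).
  by rewrite /VN (eqP Nh) /= ge_min lexx.
by rewrite VN_rec// le_min2//; apply: leeD2l; exact: Rinf_le_RN.
Qed.

(** * Running a strategy *)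

Implicit Types s : strategy R X Y.

Lemma play_rcons s y z :
  play s (rcons y z) = rcons (play s y) (control s (play s y), z).
Proof. by rewrite /play foldl_rcons. Qed.

Lemma size_play s y : size (play s y) = size y.
Proof.
by elim/last_ind: y => // y z IHy; rewrite play_rcons !size_rcons IHy.
Qed.

Lemma play_tupleP s n (y : n.-tuple Y) : size (play s y) == n.
Proof. by rewrite size_play size_tuple. Qed.

Lemma measurable_play s n :
  measurable_fun [set: n.-tuple Y] (fun y => Tuple (play_tupleP s y)).
Proof.
elim: n => [|n IHn]; first exact: measurable_tuple0.
apply: measurable_tupleS.
rewrite (_ : (fun p => _) = @snoc _ _ n \o (fun p : n.-tuple Y * Y =>
  (Tuple (play_tupleP s p.1), (control s (Tuple (play_tupleP s p.1)), p.2)))).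
  apply: measurableT_comp; first exact: measurable_snoc.
  have mplay : measurable_fun [set: n.-tuple Y * Y]
      (fun p => Tuple (play_tupleP s p.1)).
    exact: (measurableT_comp IHn measurable_fst).
  apply: measurable_fun_pair => //; apply: measurable_fun_pair => //.
  exact: (measurableT_comp (measurable_control s (n := n)) mplay).
by apply/funext => -[y z]; apply/val_inj; rewrite /= play_rcons.
Qed.

Lemma seq_mfun_play d (U : measurableType d) (F : history -> U) s :
  seq_mfun F -> seq_mfun (fun y => F (play s y)).
Proof. by move=> mF n; exact: (measurableT_comp (mF n) (measurable_play s (n := n))). Qed.

Lemma reach_rcons s h p : reach s (rcons h p) = pass s h.
Proof.
rewrite /reach /pass size_rcons; apply: eq_big_nat => i /andP[_ lt_ih].
by rewrite -cats1 takel_cat.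
Qed.

Lemma pass_nil s : pass s [::] = 1.
Proof. by rewrite /pass big_geq. Qed.

Lemma pass_reach s h : h != [::] -> pass s h = reach s h * (1 - stop s h).
Proof.
move=> h0; rewrite /pass big_nat_recr ?take_size//=.
by rewrite lt0n size_eq0.
Qed.

Lemma cont01 s h i : (0 < i)%N -> h != [::] -> 0 <= 1 - stop s (take i h) <= 1.
Proof.
move=> i0 h0; have /(stop01 s)/andP[s0 s1] : take i h != [::].
  by case: h h0 => //; case: i i0.
by rewrite subr_ge0 s1 gerBl.
Qed.

Lemma reach01 s h : 0 <= reach s h <= 1.
Proof.
have [->|h0] := eqVneq h [::]; first by rewrite /reach big_geq// ler01 lexx.
rewrite /reach big_nat_cond; apply/andP; split.
  by apply: prodr_ge0 => i /andP[/andP[i0 _] _]; case/andP: (cont01 s i0 h0).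
by apply: prodr_ile1 => i /andP[/andP[i0 _] _]; exact: cont01.
Qed.

Lemma pass01 s h : 0 <= pass s h <= 1.
Proof.
have [->|h0] := eqVneq h [::]; first by rewrite pass_nil ler01 lexx.
rewrite pass_reach//; have /andP[r0 r1] := reach01 s h.
have /andP[s0 s1] := stop01 s h0.
by rewrite mulr_ge0 ?subr_ge0//= mulr_ile1 ?subr_ge0// gerBl.
Qed.

Lemma stop_at_ge0 s h : h != [::] -> 0 <= stop_at s h.
Proof.
move=> h0; have /andP[r0 _] := reach01 s h; have /andP[s0 _] := stop01 s h0.
by rewrite mulr_ge0.
Qed.

Lemma measurable_stop_seq s : seq_mfun (stop s).
Proof.
case=> [|n]; first exact: measurable_tuple0.
exact: (@measurable_stop _ _ _ _ _ s n.+1).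
Qed.

Lemma measurable_reach s : seq_mfun (reach s).
Proof.
move=> n; rewrite /reach; under eq_fun do rewrite size_tuple.
apply: measurable_prod => i _; apply: measurable_funB => //.
exact: seq_mfun_take (measurable_stop_seq s) n.
Qed.

Lemma measurable_pass s : seq_mfun (pass s).
Proof.
move=> n; rewrite /pass; under eq_fun do rewrite size_tuple.
apply: measurable_prod => i _; apply: measurable_funB => //.
exact: seq_mfun_take (measurable_stop_seq s) n.
Qed.

Lemma measurable_stop_at s : seq_mfun (stop_at s).
Proof.
move=> n; apply: measurable_funM; first exact: measurable_reach.
exact: measurable_stop_seq.
Qed.

Definition run_integral s n F : \bar R := (\int[tuple_measure mu n]_y F (play s y))%E.
Local Notation J := run_integral.

Lemma run_integral0 s F : J s 0 F = F [::].
Proof. by rewrite /J (tuple_integral0 mu (fun y => F (play s y))). Qed.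

(** The control is an arbitrary measurable [c], so that this covers both strategies and the constant
    controls of the selection argument. *)
Lemma measurable_integral_next (c : history -> X) F : seq_mfun c ->
  seq_mfun F -> (forall h, 0 <= F h)%E ->
  seq_mfun (fun h => \int[mu]_z F (rcons h (c h, z)))%E.
Proof.
move=> mc mF F0 n.
apply: (@measurable_fun_fubini_tonelli_F _ _ _ _ _ _
  (fun p : n.-tuple (X * Y) * Y => F (rcons p.1 (c p.1, p.2)))) => //.
have mnext : measurable_fun [set: n.-tuple (X * Y) * Y]
    (fun p => (p.1, (c p.1, p.2))).
  apply: measurable_fun_pair => //; apply: measurable_fun_pair => //.
  exact: (measurableT_comp (mc n) measurable_fst).
exact: (measurableT_comp (seq_mfun_rcons (n := n) mF) mnext).
Qed.

Lemma run_integralS s n F : seq_mfun F -> (forall h, 0 <= F h)%E ->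
  J s n.+1 F = J s n (fun h => \int[mu]_z F (rcons h (control s h, z)))%E.
Proof.
move=> mF F0; rewrite /J (tuple_integralS mu n (F := fun y => F (play s y)))//.
  by apply: eq_integral => y _; apply: eq_integral => z _; rewrite play_rcons.
exact: seq_mfun_play.
Qed.

Lemma eq_run_integral s n F G : (forall h, size h = n -> F h = G h) ->
  J s n F = J s n G.
Proof.
by move=> FG; apply: eq_integral => y _; rewrite FG// size_play size_tuple.
Qed.

Lemma le_run_integral s n F G : seq_mfun F -> seq_mfun G ->
  (forall h, size h = n -> 0 <= F h)%E ->
  (forall h, size h = n -> F h <= G h)%E ->
  (J s n F <= J s n G)%E.
Proof.
move=> mF mG F0 FG; apply: ge0_le_integral => //.
- by move=> y _; rewrite F0// size_play size_tuple.
- exact: seq_mfun_play mF n.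
- exact: seq_mfun_play mG n.
- by move=> y _; rewrite FG// size_play size_tuple.
Qed.

Lemma run_integralD s n F G : seq_mfun F -> seq_mfun G ->
  (forall h, size h = n -> 0 <= F h)%E -> (forall h, size h = n -> 0 <= G h)%E ->
  J s n (fun h => F h + G h)%E = (J s n F + J s n G)%E.
Proof.
move=> mF mG F0 G0; apply: ge0_integralD => //.
- by move=> y _; rewrite F0// size_play size_tuple.
- exact: seq_mfun_play mF n.
- by move=> y _; rewrite G0// size_play size_tuple.
- exact: seq_mfun_play mG n.
Qed.

Lemma run_integral_massM s n (c : R) : 0 <= c ->
  J s n (fun h => (c * mass h)%:E) = (c * k%:R)%:E.
Proof.
move=> c0; elim: n => [|n IHn].
  rewrite run_integral0; congr (_ * _)%:E; rewrite /mass.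
  by under eq_bigr do rewrite joint_nil; rewrite sumr_const card_ord.
rewrite run_integralS -?IHn; first by apply: eq_integral => y _; rewrite integral_massM.
- by apply: seq_mfun_EFin => m; apply: measurable_funM => //; exact: measurable_mass.
- by move=> h; rewrite lee_fin mulr_ge0// mass_ge0.
Qed.

(** * Cost decomposition *)

(* Domination by [mass] makes all the integrals finite, since the integral of
   [mass] is [k] at every stage and for every strategy. *)
Definition tame G := [/\ seq_mfun G, forall h, (0 <= G h)%E &
  forall h, (G h <= (lam_norm * mass h)%:E)%E].

Lemma tame_fin G h : tame G -> G h \is a fin_num.
Proof.
by move=> [_ G0 Gle]; rewrite ge0_fin_numE// (le_lt_trans (Gle h))// ltry.
Qed.

Lemma tame_loss : tame loss.
Proof. by split; [exact: measurable_loss|exact: loss_ge0|exact: loss_le_mass]. Qed.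

Lemma tame_VN N : tame (VN N).
Proof. by split; [exact: measurable_VN|exact: VN_ge0|exact: VN_le_mass]. Qed.

Lemma tame_V : tame V.
Proof. by split; [exact: measurable_V|exact: V_ge0|exact: V_le_mass]. Qed.

Lemma tame_min_control (x0 : X) G :
  tame G -> seq_mfun (min_control G) -> tame (min_control G).
Proof.
move=> [mG G0 Gle] mc; split => // h; first exact: min_control_ge0.
exact: min_control_le_mass.
Qed.

Lemma tame_RN (x0 : X) N : tame (RN N).
Proof. exact: (@tame_min_control x0 (VN N) (tame_VN N) (measurable_RN N)). Qed.

Lemma tame_Rinf (x0 : X) : tame Rinf.
Proof.
by apply: (@tame_min_control x0 V tame_V) => n; exact: (Rinf_measurable hmin).
Qed.

Lemma tame_next s G : tame G ->
  tame (fun h => \int[mu]_z G (rcons h (control s h, z)))%E.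
Proof.
move=> [mG G0 Gle]; split;
  first exact: measurable_integral_next (measurable_control s) mG G0.
  by move=> h; exact: integral_ge0.
move=> h; rewrite -(integral_massM h (control s h) lam_norm_ge0).
apply: ge0_le_integral => //.
- exact: measurable_next.
- apply/measurable_EFinP/measurable_funM => //.
  exact: measurable_next measurable_mass.
Qed.

(** [a] counts the observations charged under theta_1: [n] when stopping at stage [n], [n.+1] when
    going on. The weight [w] will be [stop_at], [pass] or [reach]. *)
Definition weighted s n (w : history -> R) (a : nat) G : \bar R :=
  J s n (fun h => (w h)%:E * ((a%:R * joint hyp1 h)%:E + G h))%E.

Lemma measurable_weight (w : history -> R) (a : nat) G : seq_mfun w -> seq_mfun G ->
  seq_mfun (fun h => (w h)%:E * ((a%:R * joint hyp1 h)%:E + G h))%E.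
Proof.
move=> mw mG n; apply: emeasurable_funM; first by apply/measurable_EFinP; exact: mw.
apply: emeasurable_funD; last exact: mG.
by apply/measurable_EFinP/measurable_funM => //; exact: measurable_joint.
Qed.

Lemma weight_ge0 (w : R) (a : nat) h (x : \bar R) : 0 <= w -> (0 <= x)%E ->
  (0 <= w%:E * ((a%:R * joint hyp1 h)%:E + x))%E.
Proof. by move=> w0 x0; rewrite mule_ge0// adde_ge0// lee_fin mulr_ge0// joint_ge0. Qed.

(** The weight [reach] at stage [n.+1] does not involve the last observation, and [joint hyp1]
    reproduces itself when that observation is integrated out. *)
Lemma weighted_reachS s n a G : tame G ->
  weighted s n.+1 (reach s) a G =
  weighted s n (pass s) a (fun h => \int[mu]_z G (rcons h (control s h, z)))%E.
Proof.
move=> [mG G0 _]; rewrite /weighted run_integralS.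
- apply: eq_run_integral => h _; under eq_integral do rewrite reach_rcons.
  have mJ : measurable_fun setT
      (fun z => (a%:R * joint hyp1 (rcons h (control s h, z)))%:E).
    apply/measurable_EFinP/measurable_funM => //.
    exact: measurable_next (measurable_joint _).
  have mGz := measurable_next h (control s h) mG.
  have J0 z : (0 <= (a%:R * joint hyp1 (rcons h (control s h, z)))%:E)%E.
    by rewrite lee_fin mulr_ge0// joint_ge0.
  rewrite ge0_integralZl_EFin//.
  + by rewrite ge0_integralD// integral_jointM.
  + by move=> z _; rewrite adde_ge0.
  + exact: emeasurable_funD.
  + by case/andP: (pass01 s h).
- by apply: measurable_weight => //; exact: measurable_reach.
- by move=> h; apply: weight_ge0 => //; case/andP: (reach01 s h).
Qed.

(* The risk at [h] when [s] decides whether to stop and continuing is worth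
   [f_1 + G]. *)
Definition mix s G h : \bar R :=
  ((stop s h)%:E * loss h + (1 - stop s h)%:E * ((joint hyp1 h)%:E + G h))%E.

Lemma measurable_mix s G : tame G -> seq_mfun (mix s G).
Proof.
move=> [mG _ _] n; apply: emeasurable_funD; apply: emeasurable_funM.
- by apply/measurable_EFinP; exact: measurable_stop_seq.
- exact: measurable_loss.
- by apply/measurable_EFinP/measurable_funB => //; exact: measurable_stop_seq.
- apply: emeasurable_funD; last exact: mG.
  by apply/measurable_EFinP; exact: measurable_joint.
Qed.

Lemma mix_ge0 s G h : tame G -> h != [::] -> (0 <= mix s G h)%E.
Proof.
move=> [_ G0 _] h0; have /andP[s0 s1] := stop01 s h0.
rewrite adde_ge0// mule_ge0 ?loss_ge0 ?adde_ge0//.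
all: by rewrite lee_fin ?subr_ge0// joint_ge0.
Qed.

Definition cost s n := weighted s n (stop_at s) n loss.

Lemma neq_nil_size (n : nat) h : size h = n.+1 -> h != [::].
Proof. by case: h. Qed.

Lemma cost_ge0 s n : (0 <= cost s n.+1)%E.
Proof.
apply: integral_ge0 => y _; apply: weight_ge0; last exact: loss_ge0.
by apply: stop_at_ge0; rewrite (@neq_nil_size n)// size_play size_tuple.
Qed.

Lemma weighted_pass_ge0 s n a G : tame G -> (0 <= weighted s n (pass s) a G)%E.
Proof.
move=> [_ G0 _]; apply: integral_ge0 => y _; apply: weight_ge0 => //.
by case/andP: (pass01 s (play s y)).
Qed.

(** A pointwise identity: since [pass = reach * (1 - stop)], the additional observation charged to
    the continuing part is absorbed by [mix]. *)
Lemma cost_split s n G : tame G ->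
  (cost s n.+1 + weighted s n.+1 (pass s) n.+2 G =
   weighted s n.+1 (reach s) n.+1 (mix s G))%E.
Proof.
move=> tG; have [mG G0 _] := tG.
rewrite /cost /weighted -run_integralD.
- apply: eq_run_integral => h /neq_nil_size h0.
  have [l] : exists l, loss h = l%:E.
    by exists (fine (loss h)); rewrite fineK// tame_fin//; exact: tame_loss.
  have [g] : exists g, G h = g%:E by exists (fine (G h)); rewrite fineK// tame_fin.
  rewrite /mix pass_reach// /stop_at => -> ->; rewrite -!(EFinM, EFinD).
  by congr EFin; rewrite -[n.+2%:R]natr1; ring.
- by apply: measurable_weight; [exact: measurable_stop_at|exact: measurable_loss].
- by apply: measurable_weight => //; exact: measurable_pass.
- move=> h /neq_nil_size h0; apply: weight_ge0; last exact: loss_ge0.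
  exact: stop_at_ge0.
- by move=> h _; apply: weight_ge0 => //; case/andP: (pass01 s h).
Qed.

Lemma le_weighted s n (w : history -> R) a F G : seq_mfun w -> seq_mfun F -> seq_mfun G ->
  (forall h, size h = n -> 0 <= w h) -> (forall h, size h = n -> 0 <= F h)%E ->
  (forall h, size h = n -> F h <= G h)%E ->
  (weighted s n w a F <= weighted s n w a G)%E.
Proof.
move=> mw mF mG w0 F0 FG; apply: le_run_integral.
- exact: measurable_weight.
- exact: measurable_weight.
- by move=> h hn; apply: weight_ge0; [exact: w0|exact: F0].
- by move=> h hn; apply: lee_wpmul2l; [rewrite lee_fin w0|rewrite leeD2l// FG].
Qed.

(** A convex combination of two numbers is at least their minimum. *)
Lemma V_le_mix s h : h != [::] -> (V h <= mix s Rinf h)%E.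
Proof.
move=> h0; have /andP[s0 s1] := stop01 s h0; rewrite V_rec /mix.
set m := mine _ _; have {1}-> : m = ((stop s h)%:E * m + (1 - stop s h)%:E * m)%E.
  rewrite -ge0_muleDl ?lee_fin ?subr_ge0// -EFinD addrCA subrr addr0 mul1e//.
by apply: leeD; apply: lee_wpmul2l; rewrite ?lee_fin ?subr_ge0// ge_min lexx ?orbT.
Qed.

Lemma weighted_pass_le_reachS s n a :
  (weighted s n (pass s) a Rinf <= weighted s n.+1 (reach s) a V)%E.
Proof.
have [mR R0 _] := tame_Rinf (control s [::]).
rewrite weighted_reachS; last exact: tame_V.
have [mN _ _] := tame_next s tame_V.
apply: le_weighted => //.
- exact: measurable_pass.
- by move=> h _; case/andP: (pass01 s h).
- by move=> h _; exact: min_control_le.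
Qed.

Lemma weighted_reach_le_cost s n :
  (weighted s n.+1 (reach s) n.+1 V <=
   cost s n.+1 + weighted s n.+1 (pass s) n.+2 Rinf)%E.
Proof.
have tR := tame_Rinf (control s [::]).
rewrite cost_split//; apply: le_weighted.
- exact: measurable_reach.
- exact: measurable_V.
- exact: measurable_mix.
- by move=> h _; case/andP: (reach01 s h).
- by move=> h _; exact: V_ge0.
- by move=> h /neq_nil_size; exact: V_le_mix.
Qed.

(* The quantity A_n of the header. *)
Definition truncated_cost s n : \bar R :=
  (\sum_(1 <= j < n.+1) cost s j + weighted s n (pass s) n.+1 Rinf)%E.

Lemma truncated_cost_nondecreasing s n m : (n <= m)%N ->
  (truncated_cost s n <= truncated_cost s m)%E.
Proof.
move=> /subnK <-; elim: (m - n)%N => [|p IHp]; first by rewrite add0n.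
apply: le_trans IHp _; rewrite addSn /truncated_cost [in leRHS]big_nat_recr//=.
rewrite -addeA; apply: leeD2l; apply: le_trans (weighted_pass_le_reachS _ _ _) _.
exact: weighted_reach_le_cost.
Qed.

(** * Stopping probabilities *)

Lemma measurable_wjoint (w : history -> R) i : seq_mfun w ->
  seq_mfun (fun h => (w h * joint i h)%:E).
Proof.
move=> mw n; apply/measurable_EFinP; apply: measurable_funM; first exact: mw.
exact: measurable_joint.
Qed.

Lemma expectE i s n w :
  expect mu f i s n w = J s n (fun h => (w h * joint i h)%:E).
Proof. by []. Qed.

Lemma expect_ge0 i s n w : (forall h, size h = n -> 0 <= w h) ->
  (0 <= expect mu f i s n w)%E.
Proof.
move=> w0; apply: integral_ge0 => y _.
by rewrite lee_fin mulr_ge0 ?joint_ge0// w0// size_play size_tuple.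
Qed.

Lemma expect_pass_ge0 i s n : (0 <= expect mu f i s n (pass s))%E.
Proof. by apply: expect_ge0 => h _; case/andP: (pass01 s h). Qed.

Lemma expect_stop_at_ge0 i s n : (0 <= expect mu f i s n.+1 (stop_at s))%E.
Proof. by apply: expect_ge0 => h /neq_nil_size; exact: stop_at_ge0. Qed.

Lemma expect_pass0 i s : expect mu f i s 0 (pass s) = 1%E.
Proof.
have := run_integral0 s (fun h => (pass s h * joint i h)%:E).
by rewrite pass_nil joint_nil mulr1.
Qed.

(** P(tau > n) = P(tau = n + 1) + P(tau > n + 1): reaching stage n + 1 is the same as passing stage
    n, and there [reach] splits into [stop_at] and [pass]. *)
Lemma expect_passS i s n : expect mu f i s n (pass s) =
  (expect mu f i s n.+1 (stop_at s) + expect mu f i s n.+1 (pass s))%E.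
Proof.
rewrite -[RHS](run_integralD s (n := n.+1) (F := fun h => (stop_at s h * joint i h)%:E)
    (G := fun h => (pass s h * joint i h)%:E)).
- transitivity (J s n.+1 (fun h => (reach s h * joint i h)%:E)); last first.
    apply: eq_run_integral => h /neq_nil_size h0; rewrite pass_reach// /stop_at.
    by rewrite -EFinD; congr EFin; ring.
  rewrite expectE run_integralS.
  + apply: eq_run_integral => h _; under eq_integral do rewrite reach_rcons.
    by rewrite integral_jointM//; case/andP: (pass01 s h).
  + by apply: measurable_wjoint; exact: measurable_reach.
  + by move=> h; rewrite lee_fin mulr_ge0 ?joint_ge0//; case/andP: (reach01 s h).
- by apply: measurable_wjoint; exact: measurable_stop_at.
- by apply: measurable_wjoint; exact: measurable_pass.
- by move=> h /neq_nil_size h0; rewrite lee_fin mulr_ge0 ?joint_ge0// stop_at_ge0.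
- by move=> h _; rewrite lee_fin mulr_ge0 ?joint_ge0//; case/andP: (pass01 s h).
Qed.

Lemma expect_pass_sum i s n :
  (\sum_(1 <= j < n.+1) expect mu f i s j (stop_at s) + expect mu f i s n (pass s))%E
    = 1%E.
Proof.
elim: n => [|n IHn]; first by rewrite big_geq// add0e expect_pass0.
by rewrite big_nat_recr//= -addeA -expect_passS.
Qed.

Lemma expect_pass_le1 i s n : (expect mu f i s n (pass s) <= 1)%E.
Proof.
rewrite -(expect_pass_sum i s n) leeDr// big_nat; apply: sume_ge0 => -[|j]// _.
exact: expect_stop_at_ge0.
Qed.

Lemma expect_pass_fin i s n : expect mu f i s n (pass s) \is a fin_num.
Proof.
by rewrite ge0_fin_numE ?expect_pass_ge0// (le_lt_trans (expect_pass_le1 _ _ _))// ltry.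
Qed.

(** The partial sums are 1 - P(tau > n). For [hyp1], this selects the series in the definition of
    [objective]. *)
Lemma finite_prob_stop i s : finite_strategies mu f s -> prob_stop mu f i s = 1%E.
Proof.
move=> /(_ i) Ps; rewrite /prob_stop; apply/cvg_lim => //.
rewrite -(cvg_shiftS (fun n => \sum_(1 <= j < n) expect mu f i s j (stop_at s))%E).
have sumE n : (1 - expect mu f i s n (pass s) =
    \sum_(1 <= j < n.+1) expect mu f i s j (stop_at s))%E.
  by rewrite -(expect_pass_sum i s n) addeK// expect_pass_fin.
have : (1 - expect mu f i s n (pass s))%E @[n --> \oo] --> (1 - 0)%E.
  by apply: cvgeB => //; exact: cvg_cst.
by rewrite sube0 (funext sumE).
Qed.

(** * Truncated costs as lower bounds for the objective *)

Lemma objectiveE s : finite_strategies mu f s ->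
  objective mu hk f lam s = (\sum_(1 <= n <oo) cost s n)%E.
Proof. by move=> Fs; rewrite /objective finite_prob_stop// eqxx. Qed.

Lemma sum_cost_le_objective s n :
  (\sum_(1 <= j < n) cost s j <= objective mu hk f lam s)%E.
Proof.
rewrite /objective; case: ifP => _; last exact: leey.
by apply: nneseries_lim_ge => -[|j] // _ _; exact: cost_ge0.
Qed.

Lemma objective_le s b : finite_strategies mu f s ->
  (forall n, \sum_(1 <= j < n.+1) cost s j <= b)%E ->
  (objective mu hk f lam s <= b)%E.
Proof.
move=> Fs cb; rewrite objectiveE//; apply: lime_le.
  by apply: is_cvg_ereal_nneg_natsum => -[|j] // _; exact: cost_ge0.
by exists 1%N => // -[|n] // _; exact: cb.
Qed.

(** Stopping at stage [m.+1] charges at least [n.+1] observations, and the loss is nonnegative. *)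
Lemma expect_stop_at_le_cost s n m : (n <= m)%N ->
  (n.+1%:R%:E * expect mu f hyp1 s m.+1 (stop_at s) <= cost s m.+1)%E.
Proof.
move=> nm; rewrite /expect.
have stop0 (y : m.+1.-tuple Y) : 0 <= stop_at s (play s y).
  by apply: stop_at_ge0; rewrite (@neq_nil_size m)// size_play size_tuple.
rewrite -ge0_integralZl_EFin//.
- apply: ge0_le_integral => //.
  + by move=> y _; rewrite -EFinM lee_fin mulr_ge0// mulr_ge0// joint_ge0.
  + apply: emeasurable_funM => //.
    exact: seq_mfun_play (measurable_wjoint _ (measurable_stop_at s)) _.
  + apply: (seq_mfun_play (F := fun h => (stop_at s h)%:E *
      ((m.+1%:R * joint hyp1 h)%:E + loss h))%E).
    by apply: measurable_weight; [exact: measurable_stop_at|exact: measurable_loss].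
  + move=> y _; rewrite -EFinM mulrCA EFinM; apply: lee_wpmul2l.
      by rewrite lee_fin.
    apply: (@le_trans _ _ (m.+1%:R * joint hyp1 (play s y))%:E).
      by rewrite lee_fin ler_wpM2r ?joint_ge0// ler_nat.
    by rewrite leeDl// loss_ge0.
- by move=> y _; rewrite lee_fin mulr_ge0// joint_ge0.
- exact: seq_mfun_play (measurable_wjoint _ (measurable_stop_at s)) _.
Qed.

(** Finite form of the tail estimate for E_1 tau: those still running at [n] either stop within [m]
    stages, each at cost at least [n.+1], or are still running at [n + m]. *)
Lemma expect_pass_le_cost s n m :
  (n.+1%:R%:E * expect mu f hyp1 s n (pass s) <=
   \sum_(n.+1 <= j < (n + m).+1) cost s j +
   n.+1%:R%:E * expect mu f hyp1 s (n + m) (pass s))%E.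
Proof.
elim: m => [|m IHm]; first by rewrite addn0 big_geq// add0e.
apply: (le_trans IHm); rewrite expect_passS addnS.
rewrite [in leRHS]big_nat_recr ?ltnS ?leq_addr//= -[leRHS]addeA; apply: leeD2l.
rewrite ge0_muleDr ?expect_stop_at_ge0 ?expect_pass_ge0//; apply: leeD2r.
by apply: expect_stop_at_le_cost; exact: leq_addr.
Qed.

Lemma weighted_pass_le s n a G : tame G ->
  (weighted s n (pass s) a G <= a%:R%:E * expect mu f hyp1 s n (pass s) +
    lam_norm%:E * \sum_(i < k) expect mu f i s n (pass s))%E.
Proof.
move=> [mG G0 Gle]; have pass0 h : 0 <= pass s h by case/andP: (pass01 s h).
have mP i := seq_mfun_play s (measurable_wjoint i (measurable_pass s)) (n := n).
have P0 i y : (0 <= (pass s (play s y) * joint i (play s y))%:E)%E.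
  by rewrite lee_fin mulr_ge0// joint_ge0.
rewrite /expect -ge0_integral_sum// -!ge0_integralZl_EFin//.
- rewrite -ge0_integralD//.
  + apply: ge0_le_integral => //.
    * by move=> y _; exact: weight_ge0.
    * apply: (seq_mfun_play (F := fun h => (pass s h)%:E *
        ((a%:R * joint hyp1 h)%:E + G h))%E).
      by apply: measurable_weight => //; exact: measurable_pass.
    * apply: emeasurable_funD; first exact: emeasurable_funM.
      by apply: emeasurable_funM => //; exact: emeasurable_sum.
    * move=> y _; rewrite ge0_muleDr ?lee_fin ?mulr_ge0 ?joint_ge0//.
      apply: leeD; first by rewrite -!EFinM lee_fin mulrCA.
      under eq_bigr do rewrite EFinM; rewrite -ge0_sume_distrr; last first.
        by move=> i _; rewrite lee_fin joint_ge0.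
      by rewrite muleCA; apply: lee_wpmul2l; rewrite ?lee_fin// sumEFin -EFinM Gle.
  + by move=> y _; rewrite mule_ge0.
  + exact: emeasurable_funM.
  + by move=> y _; rewrite mule_ge0 ?lee_fin ?lam_norm_ge0 ?sume_ge0.
  + by apply: emeasurable_funM => //; exact: emeasurable_sum.
- by move=> y _; rewrite sume_ge0.
- exact: emeasurable_sum.
- exact: lam_norm_ge0.
Qed.

Lemma truncated_cost_le_objective s n : finite_strategies mu f s ->
  (truncated_cost s n <= objective mu hk f lam s)%E.
Proof.
move=> Fs; set L := objective mu hk f lam s.
have L0 : (0 <= L)%E.
  by apply: le_trans (sum_cost_le_objective s 0); rewrite big_geq.
have [Linf|Lfin] := eqVneq L +oo%E; first by rewrite Linf leey.
have {}Lfin : L \is a fin_num by rewrite ge0_fin_numE// lt_neqAle Lfin leey.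
(* [d] bounds the contribution of [Rinf] to the remainder; it vanishes in the limit because [s]
   stops under every hypothesis. *)
pose d N := (lam_norm%:E * \sum_(i < k) expect mu f i s N (pass s))%E.
have d0 : d N @[N --> \oo] --> 0%E.
  rewrite -(mule0 lam_norm%:E); apply: cvgeZl => //.
  have : (\sum_(i < k) expect mu f i s N (pass s))%E @[N --> \oo] -->
      (\sum_(i < k) (0 : \bar R))%E.
    apply: cvg_nnesum => i _; last exact: Fs.
    by apply: nearW => N; exact: expect_pass_ge0.
  by rewrite big1.
have AN N m : (truncated_cost s N <= L +
    N.+1%:R%:E * expect mu f hyp1 s (N + m) (pass s) + d N)%E.
  apply: (@le_trans _ _ (\sum_(1 <= j < N.+1) cost s j +
      (N.+1%:R%:E * expect mu f hyp1 s N (pass s) + d N))%E).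
    by apply: leeD2l; apply: weighted_pass_le; exact: tame_Rinf (control s [::]).
  rewrite addeA; apply: leeD2r.
  apply: le_trans (leeD2l _ (expect_pass_le_cost s N m)) _.
  rewrite addeA; apply: leeD2r.
  by rewrite -big_cat_nat ?leq_addr//; exact: sum_cost_le_objective.
(* First limit: [m] tends to infinity with [N] fixed, which removes the term in P_1(tau > N + m). *)
have AN' N : (truncated_cost s N <= L + d N)%E.
  have lim : (L + N.+1%:R%:E * expect mu f hyp1 s (N + m) (pass s) + d N)%E
      @[m --> \oo] --> (L + N.+1%:R%:E * 0 + d N)%E.
    apply: cvgeD; last exact: cvg_cst.
      by rewrite mule0 adde0 fin_num_adde_defr.
    apply: cvgeD; [by rewrite mule0 fin_num_adde_defl|exact: cvg_cst|].
    apply: cvgeZl => //.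
    rewrite (_ : (fun m => _) = (fun m => expect mu f hyp1 s (m + N) (pass s))).
      by move: (Fs hyp1); rewrite -(cvg_shiftn N).
    by apply/funext => m; rewrite addnC.
  rewrite mule0 adde0 in lim; apply: (ecvgn_ge (N0 := 0) lim) => m _; exact: AN.
(* Second limit: [N] tends to infinity, while monotonicity keeps the truncated cost at [n] below the
   one at [N]. *)
have lim : (L + d N)%E @[N --> \oo] --> (L + 0)%E.
  by apply: cvgeD => //; [rewrite fin_num_adde_defl|exact: cvg_cst].
rewrite adde0 in lim; apply: (ecvgn_ge (N0 := n) lim) => N nN.
exact: le_trans (truncated_cost_nondecreasing s nN) (AN' N).
Qed.

(** * Equality and the conditions (a), (b), (c) *)

Lemma eq_weighted_ae s n (w : history -> R) a F G :
  seq_mfun w -> seq_mfun F -> seq_mfun G -> (forall h, 0 <= w h) ->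
  (forall h, size h = n -> 0 <= F h)%E -> (forall h, size h = n -> 0 <= G h)%E ->
  {ae tuple_measure mu n, forall y : n.-tuple Y,
    0 < w (play s y) -> F (play s y) = G (play s y)} ->
  weighted s n w a F = weighted s n w a G.
Proof.
move=> mw mF mG w0 F0 G0 FG.
have sz (y : n.-tuple Y) : size (play s y) = n by rewrite size_play size_tuple.
apply: ge0_ae_eq_integral => //.
- exact: seq_mfun_play (measurable_weight a mw mF) n.
- exact: seq_mfun_play (measurable_weight a mw mG) n.
- by move=> y _; apply: weight_ge0 => //; exact: F0.
- by move=> y _; apply: weight_ge0 => //; exact: G0.
apply: filterS FG => y FG _.
have := w0 (play s y); rewrite le_eqVlt => /orP[/eqP <-|/FG -> //].
by rewrite !mul0e.
Qed.

Lemma weighted_eq_ae s n (w : history -> R) a F G :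
  seq_mfun w -> seq_mfun F -> seq_mfun G -> (forall h, 0 <= w h) ->
  (forall h, size h = n -> 0 <= F h)%E -> (forall h, size h = n -> F h <= G h)%E ->
  (forall h, G h \is a fin_num) ->
  weighted s n w a G = weighted s n w a F -> weighted s n w a F \is a fin_num ->
  {ae tuple_measure mu n, forall y : n.-tuple Y,
    0 < w (play s y) -> F (play s y) = G (play s y)}.
Proof.
move=> mw mF mG w0 F0 FG Gfin eqFG Ffin.
have sz (y : n.-tuple Y) : size (play s y) = n by rewrite size_play size_tuple.
have := @ge0_integral_eq_ae _ _ _ (tuple_measure mu n) _ _
  (seq_mfun_play s (measurable_weight a mw mF) (n := n))
  (seq_mfun_play s (measurable_weight a mw mG) (n := n)).
move=> /(_ _ _ _ eqFG) ae_eq.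
have {}ae_eq : {ae tuple_measure mu n, forall y : n.-tuple Y,
    (w (play s y))%:E * ((a%:R * joint hyp1 (play s y))%:E + F (play s y)) =
    (w (play s y))%:E * ((a%:R * joint hyp1 (play s y))%:E + G (play s y))}%E.
  apply: ae_eq.
  - by move=> y; apply: weight_ge0 => //; exact: F0.
  - move=> y; apply: lee_wpmul2l; first by rewrite lee_fin.
    by apply: leeD2l; exact: FG.
  - by move=> y; rewrite ltey_eq fin_numM// fin_numD /= Gfin.
  - by rewrite -/(weighted s n w a F) ltey_eq Ffin.
(* Where [w] is positive it can be divided out, and the finite term in [joint hyp1] cancels. *)
apply: filterS ae_eq => y /[swap] wy /(congr1 (mule (w (play s y))^-1%:E)).
rewrite !muleA -EFinM mulVf ?gt_eqF// !mul1e.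
by apply: fin_addeI.
Qed.

Lemma truncated_cost0 s : truncated_cost s 0 = (1 + Rinf [::])%E.
Proof.
rewrite /truncated_cost big_geq// add0e /weighted run_integral0.
by rewrite pass_nil joint_nil mul1e mulr1.
Qed.

Lemma initial_risk_le_objective s : finite_strategies mu f s ->
  (1 + Rinf [::] <= objective mu hk f lam s)%E.
Proof. by rewrite -(truncated_cost0 s); exact: truncated_cost_le_objective. Qed.

(** A convex combination attains the minimum exactly when its weight sits on the smaller term, with
    freedom only in case of a tie; this is condition (a) at one history. *)
Lemma stop_rule_mix s h : h != [::] ->
  (\1_[set h | (loss h < (joint hyp1 h)%:E + Rinf h)%E] h <= stop s h <=
   \1_[set h | (loss h <= (joint hyp1 h)%:E + Rinf h)%E] h) <->
  V h = mix s Rinf h.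
Proof.
move=> h0; have /andP[] := stop01 s h0.
have [l hl] : exists l, loss h = l%:E.
  by exists (fine (loss h)); rewrite fineK// tame_fin//; exact: tame_loss.
have [r hr] : exists r, Rinf h = r%:E.
  exists (fine (Rinf h)); rewrite fineK// tame_fin//.
  exact: tame_Rinf (control s [::]).
rewrite V_rec /mix hl hr -!(EFinM, EFinD) -EFin_min !indicE.
have -> : (h \in [set h | (loss h < (joint hyp1 h)%:E + Rinf h)%E]) =
    (l < joint hyp1 h + r).
  by rewrite -lte_fin EFinD -hl -hr; apply/idP/idP => [/set_mem|/mem_set].
have -> : (h \in [set h | (loss h <= (joint hyp1 h)%:E + Rinf h)%E]) =
    (l <= joint hyp1 h + r).
  by rewrite -lee_fin EFinD -hl -hr; apply/idP/idP => [/set_mem|/mem_set].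
move: (joint hyp1 h) (stop s h) => j q q0 q1; split.
  case: (ltgtP l (j + r)) => [_|_|->] /= /andP[qge qle]; congr EFin.
  - have -> : q = 1 by apply/eqP; rewrite eq_le q1.
    by ring.
  - have -> : q = 0 by apply/eqP; rewrite eq_le q0 andbT.
    by ring.
  - by ring.
move=> [] eqm; case: (ltgtP l (j + r)) eqm => [lt_l|gt_l|_] eqm /=; last 1 first.
- by rewrite q0 q1.
- have : (1 - q) * (j + r - l) = 0.
    transitivity (q * l + (1 - q) * (j + r) - l); first by ring.
    by rewrite -eqm subrr.
  move/eqP; rewrite mulf_eq0 (gt_eqF (_ : 0 < j + r - l)) ?subr_gt0// orbF.
  by rewrite subr_eq0 => /eqP <-; rewrite lexx.
- have : q * (l - (j + r)) = 0.
    transitivity (q * l + (1 - q) * (j + r) - (j + r)); first by ring.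
    by rewrite -eqm subrr.
  move/eqP; rewrite mulf_eq0 (gt_eqF (_ : 0 < l - (j + r))) ?subr_gt0// orbF.
  by move/eqP ->; rewrite lexx.
Qed.

(** * Sufficiency: the conditions make the truncated cost constant *)

Section sufficiency.
Context (s : strategy R X Y) (stopC : stop_condition mu hk f lam s)
  (ctrlC : control_condition mu hk f lam s)
  (ctrl1 : first_control_condition mu hk f lam s).

Let tR : tame Rinf := tame_Rinf (control s [::]).

Lemma control_condition_weighted n a :
  weighted s n.+1 (reach s) a V = weighted s n (pass s) a Rinf.
Proof.
rewrite weighted_reachS; last exact: tame_V.
have [mI I0 _] := tame_next s tame_V; have [mR R0 _] := tR.
(* Stage 0 has only the empty history and uses (c); later stages use (b). *)
case: n => [|n].
  rewrite /weighted !run_integral0; congr (_ * (_ + _))%E; rewrite -ctrl1.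
  by apply: eq_integral => z _; rewrite (play_rcons s [::] z).
apply: eq_weighted_ae => //.
- exact: measurable_pass.
- by move=> h; case/andP: (pass01 s h).
have := ctrlC (ltn0Sn n); apply: filterS => y ctrly /ctrly <-.
by apply: eq_integral => z _; rewrite play_rcons.
Qed.

Lemma stop_condition_weighted n :
  weighted s n.+1 (reach s) n.+1 V = (cost s n.+1 + weighted s n.+1 (pass s) n.+2 Rinf)%E.
Proof.
have mM := measurable_mix s tR; have [mV V0 _] := tame_V.
rewrite cost_split//; apply: eq_weighted_ae => //.
- exact: measurable_reach.
- by move=> h; case/andP: (reach01 s h).
- by move=> h /neq_nil_size; exact: mix_ge0.
have := stopC (ltn0Sn n); apply: filterS => y stopy /stopy.
by move/stop_rule_mix; apply; apply: (@neq_nil_size n); rewrite size_play size_tuple.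
Qed.

Lemma conditions_truncated_cost n : truncated_cost s n = (1 + Rinf [::])%E.
Proof.
elim: n => [|n <-]; first exact: truncated_cost0.
rewrite /truncated_cost [in LHS]big_nat_recr//= -[LHS]addeA; congr (_ + _)%E.
by rewrite -stop_condition_weighted control_condition_weighted.
Qed.

(** The partial sums of costs stay below the constant truncated cost 1 + R_0, a lower bound for the
    objective of every competitor in the class. *)
Lemma conditions_optimal : finite_strategies mu f s -> optimal mu hk f lam s.
Proof.
move=> Fs; apply/eqP; rewrite eq_le; apply/andP; split.
  apply/ereal_infP => _ [s' Fs' <-].
  apply: le_trans (initial_risk_le_objective Fs').
  apply: objective_le => // n; rewrite -(conditions_truncated_cost n).
  by rewrite leeDl// weighted_pass_ge0.
by apply: ereal_inf_lbound; exists s.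
Qed.

End sufficiency.

(** * Necessity: a strategy that attains the initial risk *)

Section necessity.
Context (s : strategy R X Y) (Fs : finite_strategies mu f s)
  (sle : (objective mu hk f lam s <= 1 + Rinf [::])%E).

Let tR : tame Rinf := tame_Rinf (control s [::]).

(** Squeezed between its value at stage 0 and the objective. *)
Lemma optimal_truncated_cost n : truncated_cost s n = (1 + Rinf [::])%E.
Proof.
apply/eqP; rewrite eq_le (le_trans (truncated_cost_le_objective n Fs) sle)/=.
by rewrite -(truncated_cost0 s) truncated_cost_nondecreasing.
Qed.

Let initial_risk_fin : (1 + Rinf [::])%E \is a fin_num.
Proof. by rewrite fin_numD /= tame_fin. Qed.

Let weighted_pass_fin n : weighted s n (pass s) n.+1 Rinf \is a fin_num.
Proof.
have := initial_risk_fin; rewrite -(optimal_truncated_cost n) fin_numD.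
by case/andP.
Qed.

(** The step from A_n to A_(n+1) consists of two inequalities; a constant and finite A_n forces both
    to be equalities. *)
Lemma optimal_weighted n :
  weighted s n.+1 (reach s) n.+1 V = weighted s n (pass s) n.+1 Rinf /\
  weighted s n.+1 (reach s) n.+1 V =
    (cost s n.+1 + weighted s n.+1 (pass s) n.+2 Rinf)%E.
Proof.
have eqB : weighted s n (pass s) n.+1 Rinf =
    (cost s n.+1 + weighted s n.+1 (pass s) n.+2 Rinf)%E.
  have := optimal_truncated_cost n.+1; rewrite -(optimal_truncated_cost n).
  rewrite /truncated_cost [in LHS]big_nat_recr//= -[LHS]addeA.
  have := initial_risk_fin; rewrite -(optimal_truncated_cost n) fin_numD.
  by move=> /andP[Sfin _] /(fin_addeI Sfin).
have le1 := weighted_pass_le_reachS s n n.+1.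
have le2 := weighted_reach_le_cost s n.
suff -> : weighted s n.+1 (reach s) n.+1 V = weighted s n (pass s) n.+1 Rinf by [].
by apply/eqP; rewrite eq_le le1 andbT eqB.
Qed.

Lemma optimal_stop_condition : stop_condition mu hk f lam s.
Proof.
case=> // n _; have mM := measurable_mix s tR; have [mV V0 _] := tame_V.
have [eq1 eq2] := optimal_weighted n; rewrite cost_split// in eq2.
have Mfin h : mix s Rinf h \is a fin_num.
  by rewrite /mix fin_numD !fin_numM// ?fin_numD ?tame_fin//; exact: tame_loss.
have : {ae tuple_measure mu n.+1, forall y : n.+1.-tuple Y,
    0 < reach s (play s y) -> V (play s y) = mix s Rinf (play s y)}.
  apply: (@weighted_eq_ae _ _ _ n.+1) => //.
  - exact: measurable_reach.
  - by move=> h; case/andP: (reach01 s h).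
  - by move=> h /neq_nil_size; exact: V_le_mix.
  - by rewrite eq1 weighted_pass_fin.
apply: filterS => y Vy /Vy; move/stop_rule_mix; apply.
by apply: (@neq_nil_size n); rewrite size_play size_tuple.
Qed.

Lemma optimal_control_condition : control_condition mu hk f lam s.
Proof.
case=> // n _; have [mR R0 _] := tR; have tI := tame_next s tame_V.
have [mI I0 _] := tI; have [eq1 _] := optimal_weighted n.+1.
rewrite weighted_reachS in eq1; last exact: tame_V.
have : {ae tuple_measure mu n.+1, forall y : n.+1.-tuple Y,
    0 < pass s (play s y) -> Rinf (play s y) =
    (\int[mu]_z V (rcons (play s y) (control s (play s y), z)))%E}.
  apply: weighted_eq_ae _ _ _ _ _ _ _ eq1 _ => //.
  - exact: measurable_pass.
  - by move=> h; case/andP: (pass01 s h).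
  - by move=> h _; exact: min_control_le.
  - by move=> h; exact: tame_fin tI.
apply: filterS => y Ry /Ry ->.
by apply: eq_integral => z _; rewrite play_rcons.
Qed.

Lemma optimal_first_control_condition : first_control_condition mu hk f lam s.
Proof.
have [eq1 _] := optimal_weighted 0; rewrite weighted_reachS in eq1; last exact: tame_V.
move: eq1; rewrite /weighted !run_integral0 pass_nil !mul1e => /fin_addeI eq1.
by rewrite /first_control_condition -eq1.
Qed.

End necessity.

(** * Near-optimal truncated strategies *)

(** An l^1 distance between vectors of joint densities, not between histories: distinct histories
    may be at distance 0. *)
Definition dist h h' : R := \sum_(i < k) `|joint i h - joint i h'|.

Definition lipschitz G (C : R) :=
  forall h h', (G h <= G h' + (C * dist h h')%:E)%E.

Lemma dist_ge0 h h' : 0 <= dist h h'.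
Proof. by rewrite sumr_ge0. Qed.

Lemma distC h h' : dist h h' = dist h' h.
Proof. by apply: eq_bigr => i _; rewrite distrC. Qed.

(** Appending the same pair to both histories multiplies the i-th difference by [f i x z], which
    integrates to 1. Hence integration preserves Lipschitz constants. *)
Lemma integral_dist (C : R) h h' x : 0 <= C ->
  (\int[mu]_z (C * dist (rcons h (x, z)) (rcons h' (x, z)))%:E =
   (C * dist h h')%:E)%E.
Proof.
move=> C0; have distE z : C * dist (rcons h (x, z)) (rcons h' (x, z)) =
    \sum_(i < k) (C * `|joint i h - joint i h'|) * f i x z.
  rewrite mulr_sumr; apply: eq_bigr => i _.
  by rewrite !joint_rcons -mulrBl normrM (ger0_norm (density_ge0 hf _ _ _)) mulrA.
have mf i : measurable_fun setT (fun z => (f i x z)%:E).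
  apply/measurable_EFinP.
  exact: measurableT_comp (density_measurable hf i) (@measurable_pair1 _ _ _ _ x).
under eq_integral do rewrite distE -sumEFin; rewrite ge0_integral_sum//.
- rewrite mulr_sumr -sumEFin; apply: eq_bigr => i _.
  under eq_integral do rewrite EFinM.
  rewrite ge0_integralZl_EFin ?(density_int1 hf) ?mule1//.
  + by move=> z _; rewrite lee_fin (density_ge0 hf).
  + by rewrite mulr_ge0.
- by move=> i; under eq_fun do rewrite EFinM; exact: emeasurable_funM.
- by move=> i z _; rewrite lee_fin !mulr_ge0// (density_ge0 hf).
Qed.

Lemma integral_lipschitz G (C : R) h h' x : seq_mfun G -> (forall h, 0 <= G h)%E ->
  0 <= C -> lipschitz G C ->
  (\int[mu]_z G (rcons h (x, z)) <=
   \int[mu]_z G (rcons h' (x, z)) + (C * dist h h')%:E)%E.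
Proof.
move=> mG G0 C0 GC; rewrite -(integral_dist h h' x C0).
have mGx h0 := measurable_next h0 x mG.
have md : measurable_fun setT (fun z => (C * dist (rcons h (x, z)) (rcons h' (x, z)))%:E).
  apply/measurable_EFinP/measurable_funM => //; apply: measurable_sum => i.
  apply: measurableT_comp => //; apply: measurable_funB.
    exact: measurable_next (measurable_joint i).
  exact: measurable_next (measurable_joint i).
rewrite -ge0_integralD//.
- by apply: ge0_le_integral => //; exact: emeasurable_funD.
- by move=> z _; rewrite lee_fin mulr_ge0// dist_ge0.
Qed.

Lemma min_control_lipschitz G (C : R) : seq_mfun G -> (forall h, 0 <= G h)%E ->
  0 <= C -> lipschitz G C -> lipschitz (min_control G) C.
Proof.
move=> mG G0 C0 GC h h'; rewrite -leeBlDr//; apply/ereal_infP => _ [x _ <-].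
rewrite leeBlDr//; apply: le_trans (min_control_le G h x) _.
exact: integral_lipschitz.
Qed.

Lemma loss_lipschitz : lipschitz loss lam_norm.
Proof.
move=> h h'; rewrite -leeBlDr//; apply: le_bigmin => [|j _]; first exact: leey.
rewrite leeBlDr//; apply: (le_trans (bigmin_le _ j _)).
rewrite -EFinD lee_fin -lerBlDl -sumrB /dist mulr_sumr big_mkcond ler_sum// => i _.
case: ifPn => ij; last by rewrite mulr_ge0// lam_norm_ge0.
rewrite -mulrBr; apply: le_trans (ler_wpM2l (hlam ij) (ler_norm _)) _.
by rewrite ler_wpM2r// lam_le_norm.
Qed.

Lemma value_togo_lipschitz m :
  exists2 C, 0 <= C & lipschitz (value_togo m) C.
Proof.
elim: m => [|m [C C0 IHm]].
  by exists lam_norm; [exact: lam_norm_ge0|exact: loss_lipschitz].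
have C1 : 0 <= C + 1 by rewrite addr_ge0.
(* A sum that exceeds the constants of both branches: [lam_norm] for stopping, and for continuing
   [C] plus 1 for the term [joint hyp1]. *)
exists (lam_norm + (C + 1)); first by rewrite addr_ge0// lam_norm_ge0.
move=> h h'; rewrite value_togoS -leeBlDr// le_min !leeBlDr//.
have dD (D D' : R) : 0 <= D' -> ((D * dist h h')%:E <= ((D + D') * dist h h')%:E)%E.
  by move=> D0; rewrite lee_fin mulrDl lerDl mulr_ge0// dist_ge0.
apply/andP; split.
  rewrite ge_min; apply/orP; left; apply: le_trans (loss_lipschitz h h') _.
  by apply: leeD2l; exact: dD.
rewrite ge_min; apply/orP; right.
have Clip := min_control_lipschitz (measurable_value_togo m) (@value_togo_ge0 m)
  C0 IHm h h'.
have jlip : ((joint hyp1 h)%:E <= (joint hyp1 h')%:E + (dist h h')%:E)%E.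
  rewrite -EFinD lee_fin -lerBlDl /dist (bigD1 hyp1)//=.
  by apply: le_trans (ler_norm _) _; rewrite lerDl sumr_ge0.
apply: (@le_trans _ _ ((joint hyp1 h')%:E + (dist h h')%:E +
    (min_control (value_togo m) h' + (C * dist h h')%:E))%E).
  exact: leeD.
rewrite addeACA; apply: leeD2l; rewrite -EFinD lee_fin.
rewrite -{1}[dist h h']mul1r -mulrDl ler_wpM2r ?dist_ge0//.
by rewrite [1 + C]addrC lerDr lam_norm_ge0.
Qed.

(** * Countably many controls and measurable selection *)

Lemma joint_dense : exists e : nat -> history, forall h p, exists j,
  dist h (e j) <= k%:R / p.+1%:R.
Proof.
(* One representative history for each nonempty cell of a grid of mesh
   1 / (p + 1). *)
pose cell p h : {ffun 'I_k -> int} := [ffun i => Num.floor (joint i h * p.+1%:R)].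
have /choice[r rP] (q : nat * {ffun 'I_k -> int}) :
    exists h, forall h', cell q.1 h' = q.2 -> cell q.1 h = q.2.
  have [[h hq]|noh] := pselect (exists h, cell q.1 h = q.2); first by exists h.
  by exists [::] => h' hq; exfalso; apply: noh; exists h'.
exists (fun j => if unpickle j is Some q then r q else [::]) => h p.
exists (pickle (p, cell p h)); rewrite pickleK; set h' := r _.
have cellE : cell p h' = cell p h by apply: (rP (p, cell p h) h).
have -> : k%:R / p.+1%:R = \sum_(i < k) p.+1%:R^-1 :> R.
  by rewrite sumr_const card_ord mulr_natl.
apply: ler_sum => i _; rewrite -[leRHS]mul1r ler_pdivlMr//.
have := congr1 (fun c : {ffun 'I_k -> int} => c i) cellE; rewrite !ffunE => fl.
rewrite -[X in _ * X]ger0_norm// -normrM mulrBl.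
have := floor_le (joint i h * p.+1%:R); have := floor_le (joint i h' * p.+1%:R).
have := lt_succ_floor (joint i h * p.+1%:R).
have := lt_succ_floor (joint i h' * p.+1%:R).
rewrite fl ler_norml => *; apply/andP; split; lra.
Qed.

(** Take a near-minimizer at each representative history, for each precision; the Lipschitz bound
    carries it over to all nearby histories. *)
Lemma countable_min_control G (C : R) : tame G -> 0 <= C -> lipschitz G C -> X ->
  exists D : nat -> X, forall h (e : R), 0 < e -> exists q,
    (\int[mu]_z G (rcons h (D q, z)) <= min_control G h + e%:E)%E.
Proof.
move=> tG C0 GC x0; have [mG G0 Gle] := tG.
have [r rP] := joint_dense.
have mfin h : min_control G h \is a fin_num.
  rewrite ge0_fin_numE ?min_control_ge0//.
  by apply: le_lt_trans (min_control_le_mass h x0 mG G0 Gle) _; rewrite ltry.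
have /choice[D DP] (q : nat * nat) : exists x,
    (\int[mu]_z G (rcons (r q.1) (x, z)) <= min_control G (r q.1) + (q.2.+1%:R^-1)%:E)%E.
  have q0 : 0 < q.2.+1%:R^-1 :> R by rewrite invr_gt0.
  have [_ [x _ <-] lt_x] := lb_ereal_inf_adherent q0 (mfin (r q.1)).
  by exists x; exact: ltW.
exists (fun j => if unpickle j is Some q then D q else x0) => h e e0.
(* Total error in units of 1 / (p + 1): two Lipschitz transfers between [h] and its representative,
   each [C * k], and 1 for the near-minimizer. *)
pose c := 2 * C * k%:R + 1.
have c0 : 0 < c by rewrite ltr_pwDr// !mulr_ge0.
pose p := Num.truncn (c / e).
have pe : c / p.+1%:R <= e.
  rewrite ler_pdivrMr// -ler_pdivrMl// mulrC; apply: ltW.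
  by rewrite truncnS_gt// divr_ge0 ?ltW.
have [j jh] := rP h p; exists (pickle (j, p)); rewrite pickleK.
have hj : ((C * dist h (r j))%:E <= (C * (k%:R / p.+1%:R))%:E)%E.
  by rewrite lee_fin ler_wpM2l.
have jh' : ((C * dist (r j) h)%:E <= (C * (k%:R / p.+1%:R))%:E)%E.
  by rewrite distC.
apply: le_trans (integral_lipschitz h (r j) (D (j, p)) mG G0 C0 GC) _.
apply: le_trans (leeD (DP (j, p)) hj) _ => /=.
have := min_control_lipschitz mG G0 C0 GC (r j) h => /le_trans/(_ (leeD2l _ jh')) le_j.
apply: le_trans (leeD2r _ (leeD2r _ le_j)) _.
rewrite -!addeA; apply: leeD2l; rewrite -!EFinD lee_fin.
apply: le_trans pe; rewrite /c le_eqVlt; apply/orP; left; apply/eqP.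
by set q := _^-1; ring.
Qed.

(** The tolerance is proportional to [mass], not constant, because it must be integrated against a
    possibly infinite measure. The control chosen is the first good one in the countable family. *)
Lemma min_control_selector G (C : R) (x0 : X) (e : R) :
  tame G -> seq_mfun (min_control G) ->
  0 <= C -> lipschitz G C -> 0 < e ->
  exists2 c : history -> X, seq_mfun c & forall h,
    (\int[mu]_z G (rcons h (c h, z)) <= min_control G h + (e * mass h)%:E)%E.
Proof.
move=> tG mmin C0 GC e0; have [mG G0 Gle] := tG.
have [D DP] := countable_min_control tG C0 GC x0.
pose good h q := (\int[mu]_z G (rcons h (D q, z)) <= min_control G h + (e * mass h)%:E)%E.
have exgood h : exists q, good h q.
  have := mass_ge0 h; rewrite le_eqVlt => /orP[/eqP mass0|mass0]; last first.
    by apply: DP; rewrite mulr_gt0.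
  (* With zero mass there is no tolerance left, but then the integral is 0 for any control. *)
  exists 0%N; rewrite /good -mass0 mulr0 adde0.
  apply: (@le_trans _ _ 0%E); last exact: min_control_ge0.
  have -> : 0%E = (lam_norm * mass h)%:E :> \bar R by rewrite -mass0 mulr0.
  rewrite -(integral_massM h (D 0) lam_norm_ge0).
  apply: ge0_le_integral => //; first exact: measurable_next.
  by apply/measurable_EFinP/measurable_funM => //; exact: measurable_next measurable_mass.
exists (fun h => D (ex_minn (exgood h))); last by move=> h; case: ex_minnP.
move=> n; pose idx (h : n.-tuple (X * Y)) := ex_minn (exgood h).
have mgood q : measurable [set h : n.-tuple (X * Y) | good h q].
  rewrite -[X in measurable X]setTI; apply: measurable_lee => //.
    by apply: (measurable_integral_next (c := fun=> D q)) => // m; exact: measurable_cst.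
  apply: emeasurable_funD; first exact: mmin.
  by apply/measurable_EFinP/measurable_funM => //; exact: measurable_mass.
have midx q : measurable (idx @^-1` [set q]).
  (* First good index [q]: good at [q] and at no smaller index. *)
  have -> : idx @^-1` [set q] = [set h : n.-tuple (X * Y) | good h q] `\`
      \bigcup_(q' in `I_q) [set h : n.-tuple (X * Y) | good h q'].
    apply/seteqP; split => h /=; rewrite /idx; case: ex_minnP => m gm minm.
      by move=> <-; split => // -[q' /= q'm /minm]; rewrite leqNgt q'm.
    move=> [gq noq]; apply/eqP; rewrite eqn_leq minm//= leqNgt; apply/negP => mq.
    by apply: noq; exists m.
  by apply: measurableD => //; exact: bigcup_measurable.
move=> _ B mB; rewrite setTI.
suff -> : (fun h : n.-tuple (X * Y) => D (ex_minn (exgood h))) @^-1` B =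
    \bigcup_(q in [set q | B (D q)]) (idx @^-1` [set q]).
  exact: bigcup_measurable.
apply/seteqP; split => [h Bh|h [q /= Bq idxq]]; first by exists (idx h).
by rewrite -/(idx h) idxq.
Qed.

(** * A nearly optimal strategy with horizon [N] *)

Section truncated_strategy.
Context (N : nat) (c : history -> X) (e : R).
Context (N0 : (0 < N)%N) (mc : seq_mfun c) (e0 : 0 <= e)
  (c_near_min : forall h, (size h < N)%N ->
    (\int[mu]_z VN N (rcons h (c h, z)) <= RN N h + (e * mass h)%:E)%E).

Definition truncated_stop h : R :=
  if (N <= size h)%N || (loss h <= (joint hyp1 h)%:E + RN N h)%E then 1 else 0.

Lemma measurable_truncated_stop n : (0 < n)%N -> measurable_fun
  [set: n.-tuple (X * Y)] (fun h : n.-tuple (X * Y) => truncated_stop h).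
Proof.
move=> _; rewrite /truncated_stop; under eq_fun do rewrite size_tuple.
apply: measurable_fun_ifT => //; apply: measurable_or => //.
apply: (@measurable_fun_bool _ _ _ _ true); rewrite setTI -[X in measurable X]setTI.
apply: measurable_lee => //; first exact: measurable_loss.
apply: emeasurable_funD; last exact: measurable_RN.
by apply/measurable_EFinP; exact: measurable_joint.
Qed.

Lemma truncated_stop01 h : h != [::] -> 0 <= truncated_stop h <= 1.
Proof. by rewrite /truncated_stop; case: ifP; rewrite ?ler01 lexx. Qed.

Definition truncated_strategy : strategy R X Y :=
  Strategy mc measurable_truncated_stop truncated_stop01.

Local Notation s := truncated_strategy.

Lemma truncated_stop_size h : size h = N -> stop s h = 1.
Proof. by move=> hN; rewrite /= /truncated_stop hN leqnn. Qed.

Lemma truncated_reach0 h : (N < size h)%N -> reach s h = 0.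
Proof.
(* Stopping is certain at [N], so that factor vanishes; [N0] places it in the range, which starts at
   1. *)
move=> Nh; apply/eqP; rewrite prodf_seq_eq0; apply/hasP; exists N.
  by rewrite mem_index_iota N0.
by rewrite truncated_stop_size ?subrr ?eqxx// size_takel// ltnW.
Qed.

Lemma truncated_pass0 h : (N <= size h)%N -> pass s h = 0.
Proof.
rewrite leq_eqVlt => /orP[/eqP Nh|Nh].
  by rewrite pass_reach ?truncated_stop_size ?subrr ?mulr0// -size_eq0 -Nh -lt0n.
by rewrite pass_reach ?truncated_reach0 ?mul0r// -size_eq0 -lt0n (leq_trans N0)// ltnW.
Qed.

Lemma truncated_finite : finite_strategies mu f s.
Proof.
move=> i; apply: cvg_near_cst; exists N => // n /= Nn.
rewrite expectE /run_integral; apply: integral0_eq => y _.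
by rewrite truncated_pass0 ?mul0r// size_play size_tuple.
Qed.

Lemma truncated_cost_eq0 n : (N < n)%N -> cost s n = 0%E.
Proof.
move=> Nn; apply: integral0_eq => y _.
by rewrite /stop_at truncated_reach0 ?mul0r ?mul0e// size_play size_tuple.
Qed.

(** The rule picks the smaller branch of [VN_rec]. At the horizon it stops surely, and [RN] gets
    weight 0. *)
Lemma VN_mix h : (0 < size h <= N)%N -> VN N h = mix s (RN N) h.
Proof.
case/andP=> h0; rewrite leq_eqVlt => /orP[/eqP hN|hN].
  by rewrite VN_size// /mix truncated_stop_size// subrr mul0e mul1e adde0.
rewrite VN_rec// /mix /= /truncated_stop leqNgt hN /=.
case: ifPn => [le_l|]; first by rewrite subrr mul0e mul1e adde0; apply/min_idPl.
by rewrite -ltNge => lt_l; rewrite subr0 mul0e mul1e add0e; apply/min_idPr/ltW.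
Qed.

(** The backward step again, for horizon [N]: stopping is exact by [VN_mix], and the selector loses
    at most [e * k], the integral of [e * mass]. *)
Lemma truncated_step n : (n < N)%N ->
  (cost s n.+1 + weighted s n.+1 (pass s) n.+2 (RN N) <=
   weighted s n (pass s) n.+1 (RN N) + (e * k%:R)%:E)%E.
Proof.
move=> nN; have tRN := tame_RN (c [::]) N; have [mRN RN0 _] := tRN.
have pass0 h : 0 <= pass s h by case/andP: (pass01 s h).
have pass1 h : pass s h <= 1 by case/andP: (pass01 s h).
have em h : 0 <= e * mass h by rewrite mulr_ge0// mass_ge0.
have mem : seq_mfun (fun h => (e * mass h)%:E).
  by move=> m; apply/measurable_EFinP/measurable_funM => //; exact: measurable_mass.
have [mI I0 _] := tame_next s (tame_VN N).
rewrite cost_split//.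
have -> : weighted s n.+1 (reach s) n.+1 (mix s (RN N)) =
    weighted s n.+1 (reach s) n.+1 (VN N).
  by apply: eq_run_integral => h hn; rewrite VN_mix// hn.
rewrite weighted_reachS; last exact: tame_VN.
have mpRN : seq_mfun (fun h =>
    (pass s h)%:E * ((n.+1%:R * joint hyp1 h)%:E + RN N h))%E.
  by apply: measurable_weight => //; exact: measurable_pass.
rewrite -(run_integral_massM s n e0) -(run_integralD _ mpRN mem).
- apply: le_run_integral.
  + by apply: measurable_weight => //; exact: measurable_pass.
  + by move=> m; apply: emeasurable_funD; [exact: mpRN|exact: mem].
  + by move=> h _; exact: weight_ge0.
  + move=> h hn; apply: (@le_trans _ _ ((pass s h)%:E *
        ((n.+1%:R * joint hyp1 h)%:E + (RN N h + (e * mass h)%:E)))%E).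
      apply: lee_wpmul2l; first by rewrite lee_fin.
      by apply: leeD2l; apply: c_near_min; rewrite hn.
    rewrite addeA ge0_muleDr ?adde_ge0 ?lee_fin ?mulr_ge0 ?joint_ge0 ?mass_ge0//.
    by apply: leeD2l; rewrite -EFinM lee_fin ler_piMl.
- by move=> h _; exact: weight_ge0.
- by move=> h _; rewrite lee_fin.
Qed.

Lemma truncated_objective_le :
  (objective mu hk f lam s <= 1 + RN N [::] + (N%:R * (e * k%:R))%:E)%E.
Proof.
have tRN := tame_RN (c [::]) N.
have costN n : (n <= N)%N -> (\sum_(1 <= j < n.+1) cost s j +
    weighted s n (pass s) n.+1 (RN N) <=
    1 + RN N [::] + (n%:R * (e * k%:R))%:E)%E.
  elim: n => [_|n IHn nN].
    rewrite big_geq// add0e mul0r adde0 /weighted run_integral0.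
    by rewrite pass_nil joint_nil mul1e mulr1.
  rewrite big_nat_recr//= -[leLHS]addeA.
  apply: le_trans (leeD2l _ (truncated_step nN)) _; rewrite addeA.
  apply: le_trans (leeD2r _ (IHn (ltnW nN))) _.
  by rewrite -addeA -EFinD -natr1 mulrDl mul1r.
have sumN : (\sum_(1 <= j < N.+1) cost s j <=
    1 + RN N [::] + (N%:R * (e * k%:R))%:E)%E.
  by apply: le_trans (costN N (leqnn N)); rewrite leeDl// weighted_pass_ge0.
apply: objective_le => [|n]; first exact: truncated_finite.
(* Partial sums before the horizon are completed by nonnegative costs; after it, the additional
   costs are 0. *)
have [nN|Nn] := leqP n N.
  apply: le_trans sumN; rewrite (big_cat_nat _ (n := n.+1) (p := N.+1))//=.
  rewrite leeDl// big_nat; apply: sume_ge0 => -[|j] // _; exact: cost_ge0.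
rewrite (big_cat_nat _ (n := N.+1))//= ?ltnS ?(ltnW Nn)//.
rewrite [X in (_ + X)%E]big_nat [X in (_ + X)%E]big1 ?adde0// => j /andP[Nj _].
by rewrite truncated_cost_eq0.
Qed.

End truncated_strategy.

Lemma inf_objective_le_RN (x0 : X) N : (0 < N)%N ->
  (ereal_inf [set objective mu hk f lam s | s in finite_strategies mu f] <=
   1 + RN N [::])%E.
Proof.
move=> N0; apply/lee_addgt0Pr => d d0.
(* Chosen so that [N] stage errors of [e * k] add up to [d]. *)
pose e := d / (N%:R * k%:R).
have k0 : (0 < k)%N by apply: ltnW.
have e0 : 0 < e by rewrite divr_gt0// mulr_gt0// ltr0n.
have /choice[c cP] m : exists c : history -> X, seq_mfun c /\ forall h,
    (\int[mu]_z value_togo m (rcons h (c h, z)) <=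
     min_control (value_togo m) h + (e * mass h)%:E)%E.
  have [C C0 lipC] := value_togo_lipschitz m.
  have tm : tame (value_togo m).
    split; [exact: measurable_value_togo|exact: value_togo_ge0|move=> h].
    exact: le_trans (value_togo_le_loss _ _) (loss_le_mass _).
  have [c mc cP] := min_control_selector x0 tm (measurable_min_control_togo m) C0 lipC e0.
  by exists c.
(* The selector depends on the number of stages left, which the length of the history determines. *)
pose c' h := c (N - (size h).+1)%N h.
have mc' : seq_mfun c'.
  by move=> n; rewrite /c'; under eq_fun do rewrite size_tuple; exact: (cP _).1.
have c'P h : (size h < N)%N ->
    (\int[mu]_z VN N (rcons h (c' h, z)) <= RN N h + (e * mass h)%:E)%E.
  move=> _; rewrite RN_togo (eq_integral (fun z =>
    value_togo (N - (size h).+1) (rcons h (c' h, z)))); first exact: (cP _).2.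
  by move=> z _; rewrite /VN size_rcons.
have tF : finite_strategies mu f (truncated_strategy N mc').
  exact: truncated_finite.
apply: (@le_trans _ _ (objective mu hk f lam (truncated_strategy N mc'))).
  by apply: ereal_inf_lbound; exists (truncated_strategy N mc'); first exact: tF.
apply: le_trans (truncated_objective_le N0 mc' (ltW e0) c'P) _.
have -> : N%:R * (e * k%:R) = d; last by [].
rewrite /e; field; apply/andP; split; rewrite pnatr_eq0 -lt0n//.
Qed.

Lemma inf_objective_le (x0 : X) :
  (ereal_inf [set objective mu hk f lam s | s in finite_strategies mu f] <=
   1 + Rinf [::])%E.
Proof.
have lim : (1 + RN N [::])%E @[N --> \oo] --> (1 + Rinf [::])%E.
  by apply: cvgeD; [exact: fin_num_adde_defr|exact: cvg_cst|exact: RN_cvg].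
by apply: (ecvgn_ge (N0 := 1) lim) => N N0; exact: inf_objective_le_RN.
Qed.

End value_functions.

Theorem theorem6 (R : realType) (dX dY : measure_display)
    (X : measurableType dX) (Y : measurableType dY)
    (mu : {sigma_finite_measure set Y -> \bar R})
    (k : nat) (hk : (1 < k)%N)
    (f : 'I_k -> X -> Y -> R) (lam : 'I_k -> 'I_k -> R)
    (hf : is_density mu f)
    (hlam : forall i j, i != j -> 0 <= lam i j)
    (hmin : minima_attained_measurable mu hk f lam)
    (s : strategy R X Y) (hs : finite_strategies mu f s) :
  (optimal mu hk f lam s ->
     [/\ stop_condition mu hk f lam s,
         control_condition mu hk f lam s
       & first_control_condition mu hk f lam s]) /\
  (stop_condition mu hk f lam s ->
   control_condition mu hk f lam s ->
   first_control_condition mu hk f lam s ->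
   optimal mu hk f lam s).
Proof.
split=> [opt|stopC ctrlC ctrl1]; last exact: conditions_optimal.
(* Optimality enters only through this bound; [control s [::]] supplies the required element of the
   control space. *)
have sle : (objective mu hk f lam s <= 1 + Rinf mu hk f lam [::])%E.
  by rewrite opt; exact: inf_objective_le (control s [::]).
split.
- exact: optimal_stop_condition.
- exact: optimal_control_condition.
- exact: optimal_first_control_condition.
Qed.
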